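(* Let $(V,\|\cdot\|_V)$ be a nontrivial real Banach space, let $T\in(0,\infty)$, let $f\colon[0,T]\times V\to V$ be a continuous function, assume for all $t\in[0,T]$ that $V\ni x\mapsto f(t,x)\in V$ is Fréchet differentiable, and assume that $[0,T]\times V\ni(t,x)\mapsto(\frac{\partial}{\partial x}f)(t,x)\in L(V)$ is continuous. For every $x\in V$, $s\in[0,T]$ let $X^x_{s,(\cdot)}\colon[s,T]\to V$ be a continuous function which satisfies for all $t\in[s,T]$ that $X^x_{s,t}=x+\int_s^t f(\tau,X^x_{s,\tau})\,d\tau$. Let $Y,E\colon[0,T]\to V$ be strongly measurable functions which satisfy for all $t\in[0,T]$ that $\int_0^T[\|f(\tau,Y_\tau)\|_V+\|E_\tau\|_V]\,d\tau<\infty$ and $Y_t=Y_0+\int_0^t[f(\tau,Y_\tau)+E_\tau]\,d\tau$. Then: (i) for all $s\in[0,T]$, $t\in[s,T]$ the function $V\ni x\mapsto X^x_{s,t}\in V$ is Fréchet differentiable; (ii) for all $t\in[0,T]$ the function $[0,t]\ni\tau\mapsto(\frac{\partial}{\partial x}X^{Y_\tau}_{\tau,t})E_\tau\in V$ is strongly measurable; (iii) for all $t\in[0,T]$ it holds that $\int_0^t\|(\frac{\partial}{\partial x}X^{Y_\tau}_{\tau,t})E_\tau\|_V\,d\tau<\infty$; and (iv) for all $s\in[0,T]$, $t\in[s,T]$ it holds that $$Y_t=X^{Y_s}_{s,t}+\int_s^t\big(\tfrac{\partial}{\partial x}X^{Y_\tau}_{\tau,t}\big)E_\tau\,d\ta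u.$$
   Context: $L(V)$ denotes the Banach space of bounded linear operators $V\to V$ with the operator norm. A function from an interval to a Banach space is strongly measurable if it is measurable and has separable range. Integrals of $V$-valued functions are Bochner integrals with respect to Lebesgue measure. For $\tau\le t$ and $y\in V$, $\frac{\partial}{\partial x}X^{y}_{\tau,t}\in L(V)$ denotes the Fréchet derivative of $V\ni x\mapsto X^x_{\tau,t}\in V$ evaluated at $x=y$; in particular $\frac{\partial}{\partial x}X^{Y_\tau}_{\tau,t}$ is this derivative evaluated at $x=Y_\tau$. *)

(* Defs.v *)
From HB Require Import structures.
From mathcomp Require Export all_boot all_order all_algebra.
From mathcomp Require Export all_classical all_reals all_analysis.
Set Implicit Arguments.
Unset Strict Implicit.
Unset Printing Implicit Defensive.
Import Order.TTheory GRing.Theory Num.Theory.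
Import numFieldNormedType.Exports.
Local Open Scope classical_set_scope.
Local Open Scope ring_scope.

(* For continuous linear A this is the norm of A in the Banach space of bounded
   linear operators; on an unbounded set of values, sup defaults to 0. *)
Definition opnorm (R : realType) (V W : normedModType R) (A : V -> W) : R :=
  sup [set `|A x| | x in [set x : V | `|x| <= 1]].

Definition separable (T : topologicalType) (A : set T) : Prop :=
  exists C : set T, [/\ countable C, C `<=` A & A `<=` closure C].

Section strongly_measurable.
Context (d : measure_display) (T : measurableType d).
Context (R : realType) (V : normedModType R).

(* V carries its Borel sigma-algebra, generated by the open sets *)
Definition strongly_measurable (D : set T) (f : T -> V) : Prop :=
  @measurable_fun _ _ T (g_sigma_algebraType (@open V)) D f /\
  separable (f @` D).

End strongly_measurable.

Section bochner.
Context (d : measure_display) (T : measurableType d) (R : realType).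
Context (mu : {measure set T -> \bar R}) (V : normedModType R).

Definition simple_integrable (D : set T) (s : T -> V) : Prop :=
  [/\ finite_set (s @` D),
      forall v, measurable (D `&` s @^-1` [set v]) &
      forall v, v != 0 -> (mu (D `&` s @^-1` [set v]) < +oo)%E].

Definition simple_integral (D : set T) (s : T -> V) : V :=
  \sum_(v \in s @` D) fine (mu (D `&` s @^-1` [set v])) *: v.

Definition is_bochner_integral (D : set T) (f : T -> V) (v : V) : Prop :=
  strongly_measurable D f /\
  exists s : nat -> T -> V,
    [/\ forall n, simple_integrable D (s n),
        (\int[mu]_(x in D) `|f x - s n x|%:E @[n --> \oo] --> 0)%E &
        simple_integral D (s n) @[n --> \oo] --> v].

(* 0 if f is not Bochner integrable over D *)
Definition bochner_integral (D : set T) (f : T -> V) : V :=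
  xget 0 (is_bochner_integral D f).

End bochner.

(* Main.v *)
(** Fix an end time t. On a short interval [u, v] tagged at c, the flow property
    turns the increment of phi(r) = X_(r,t)(Y_r) into
    X_(v,t)(Y_v) - X_(v,t)(X_(u,v)(Y_u)). Since Y_v - X_(u,v)(Y_u) is the
    integral of E over [u, v] up to o(v - u), strict differentiability of the
    flow at (c, Y_c), uniform in the initial time, shows that the increment is
    the integral of X'_(r,t)(Y_r) E_r over [u, v] up to an arbitrarily small
    multiple of (v - u) + int_u^v |E|. Such tagged estimates add up over [s, t]
    by Cousin's lemma, so phi is never differentiated.

    Strict differentiability comes from Gronwall's inequality alone: if
    k (a - a') = l (b - b') then k (X(a) - X(a')) - l (X(b) - X(b')) is small
    relative to k (a - a'), so difference quotients of the flow converge to a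
    bounded linear map, and the linearised equation is never solved. *)
From HB Require Import structures.

From mathcomp Require Import ring lra measurable_realfun.
Require Import Defs.
Set Implicit Arguments.
Unset Strict Implicit.
Unset Printing Implicit Defensive.
Import Order.TTheory GRing.Theory Num.Theory.
Import numFieldNormedType.Exports.
Local Open Scope classical_set_scope.
Local Open Scope ring_scope.

(** Two obstacles shape the argument. Closed balls of V need not be compact, so continuity of the
    derivative of f yields bounds only near each point, and a nearby solution might a priori leave
    the region where f is Lipschitz. Comparisons are therefore made in a tube around one fixed
    solution, whose uniform radius comes from Cousin's lemma along the path, or near one fixed point
    for a short time. The second obstacle is that E is merely integrable: the increment of Y over
    [u, v] is not O(v - u). The integral of |E| in the local error makes up for this and is additive
    over adjacent intervals.

    The scalars k and l let one estimate carry the whole construction of the derivative: two step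
    sizes give the Cauchy property, a multiple of one difference gives homogeneity, an intermediate
    point gives additivity, and two initial times give uniformity in the initial time. *)

Section module_identities.
Context (R : comNzRingType) (V : lmodType R).

(** Syntax for reflection: two module expressions agree once their coefficients at every atom agree,
    which leaves scalar identities for [ring]. Atoms are numbered by literals, so simplification
    turns each test [eqn j i] into 0 or 1. *)
Inductive mexp := MVar of nat | MZero | MAdd of mexp & mexp | MOpp of mexp
  | MScale of R & mexp.

Fixpoint meval (xs : seq V) (e : mexp) : V :=
  match e with
  | MVar i => nth 0 xs i
  | MZero => 0
  | MAdd e1 e2 => meval xs e1 + meval xs e2
  | MOpp e => - meval xs e
  | MScale k e => k *: meval xs e
  end.

Fixpoint mcoef (e : mexp) (i : nat) : R :=
  match e with
  | MVar j => if eqn j i then 1 else 0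
  | MZero => 0
  | MAdd e1 e2 => mcoef e1 i + mcoef e2 i
  | MOpp e => - mcoef e i
  | MScale k e => k * mcoef e i
  end.

Fixpoint same_mcoef (e1 e2 : mexp) (n : nat) : Prop :=
  if n is n'.+1 then mcoef e1 n' = mcoef e2 n' /\ same_mcoef e1 e2 n' else True.

Lemma mevalE xs e : meval xs e = \sum_(i < size xs) mcoef e i *: nth 0 xs i.
Proof.
elim: e => [j||e1 IH1 e2 IH2|e IH|k e IH] /=.
- have [jxs|xsj] := ltnP j (size xs).
    rewrite (bigD1 (Ordinal jxs)) //= -[eqn j j]/(j == j) eqxx scale1r.
    rewrite big1 ?addr0// => i ij; rewrite -[eqn j i]/(j == i) eq_sym.
    have -> : (i == j :> nat) = false by apply/eqP => h; case/eqP: ij; exact: val_inj.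
    by rewrite scale0r.
  rewrite nth_default// big1// => i _; rewrite -[eqn j i]/(j == i).
  by rewrite gtn_eqF ?scale0r// (leq_trans (ltn_ord i)).
- by rewrite big1// => i _; rewrite scale0r.
- by rewrite IH1 IH2 -big_split; apply: eq_bigr => i _; rewrite scalerDl.
- by rewrite IH -sumrN; apply: eq_bigr => i _; rewrite scaleNr.
- by rewrite IH scaler_sumr; apply: eq_bigr => i _; rewrite scalerA.
Qed.

Lemma meval_eq xs e1 e2 : same_mcoef e1 e2 (size xs) ->
  meval xs e1 = meval xs e2.
Proof.
move=> h; rewrite !mevalE; apply: eq_bigr => -[i /= isz] _; congr (_ *: _).
elim: (size xs) h isz => [//|n IH] /= [h hn]; rewrite ltnS leq_eqVlt.
by case/predU1P => [-> //|]; exact: IH.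
Qed.

End module_identities.
Arguments MVar {R}.
Arguments MZero {R}.

Ltac lmod_index x xs :=
  lazymatch xs with
  | x :: _ => constr:(0%N)
  | _ :: ?ys => let n := lmod_index x ys in constr:(S n)
  end.

(** The last branch is a membership test: [lmod_index] fails on an atom that is not yet listed, and
    [match] then falls through to the clause that adds it. *)
Ltac lmod_atoms e xs :=
  lazymatch e with
  | (?a + ?b)%R => let ys := lmod_atoms a xs in lmod_atoms b ys
  | (- ?a)%R => lmod_atoms a xs
  | (_ *: ?a)%R => lmod_atoms a xs
  | (0)%R => xs
  | _ => match xs with
         | _ => let n := lmod_index e xs in xs
         | _ => constr:(e :: xs)
         end
  end.

Ltac lmod_reify R e xs :=
  lazymatch e with
  | (?a + ?b)%R =>
      let x := lmod_reify R a xs in let y := lmod_reify R b xs in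
      constr:(@MAdd R x y)
  | (- ?a)%R => let x := lmod_reify R a xs in constr:(@MOpp R x)
  | (?k *: ?a)%R => let x := lmod_reify R a xs in constr:(@MScale R k x)
  | (0)%R => constr:(@MZero R)
  | _ => let n := lmod_index e xs in constr:(@MVar R n)
  end.

(* Atoms are compared syntactically, not up to conversion. *)
Ltac lmod R :=
  lazymatch goal with
  | |- @eq ?V ?a ?b =>
      let ys := lmod_atoms a (@nil V) in
      let xs := lmod_atoms b ys in
      let x := lmod_reify R a xs in
      let y := lmod_reify R b xs in
      apply: (@meval_eq R _ xs x y); rewrite /=; repeat split; ring
  end.

(** * Tagged intervals and Gronwall's inequality *)

Section cousin.
Context (R : realType).
Implicit Types (a b c u v w : R).

(* Cousin's lemma; the length bound d may depend on the tag c. *)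
Lemma cousin (P : R -> R -> Prop) a b : a <= b ->
  (forall u v w, a <= u -> u <= v -> v <= w -> w <= b ->
    P u v -> P v w -> P u w) ->
  (forall c, a <= c -> c <= b -> exists2 d, 0 < d & forall u v,
    a <= u -> u <= c -> c <= v -> v <= b -> v - u < d -> P u v) ->
  P a b.
Proof.
move=> ab Ptrans Ploc.
pose S := [set x | a <= x <= b /\ P a x].
have Sa : S a.
  split; first by rewrite lexx ab.
  have [d d0] := Ploc a (lexx a) ab.
  by apply => //; rewrite subrr.
have Sb : ubound S b by move=> x [/andP[]].
have supS : has_sup S by split; [exists a | exists b].
pose c := sup S.
have ac : a <= c by apply: ub_le_sup => //; exists b.
have cb : c <= b by apply: ge_sup => //; exists a.
have [d d0 Pd] := Ploc c ac cb.
have d20 : 0 < d / 2 by rewrite divr_gt0.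
have [u [/andP[au ub] Pau] cu] := sup_adherent d20 supS.
have uc : u <= c by apply: ub_le_sup; [exists b | split; [apply/andP|]].
(* Since [u] lies in S within d/2 of the supremum c, the interval [u, v] is tagged at c and shorter
   than d. If c < b, this reaches beyond c, which is absurd. *)
have key v : c <= v -> v <= b -> v < c + d / 2 -> P a v.
  move=> cv vb vc; apply: (Ptrans _ u) => //; first exact: le_trans cv.
  by apply: Pd => //; rewrite -/c in cu; lra.
have [<-|cnb] := eqVneq c b; first by apply: key => //; lra.
have {cnb}cb' : c < b by rewrite lt_neqAle cnb.
pose v := Num.min b (c + d / 4).
have vb : v <= b by rewrite /v ge_min lexx.
have cv : c < v by rewrite lt_min cb' /=; lra.
have vd : v < c + d / 2 by rewrite gt_min; apply/orP; right; lra.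
have : v <= c.
  apply: ub_le_sup; first by exists b.
  split; first by rewrite vb andbT (le_trans ac) // ltW.
  by apply: key => //; exact: ltW.
by rewrite leNgt cv.
Qed.

End cousin.

Section tagged_derivative.
Context (R : realType) (V : normedModType R).
Implicit Types (a b c d e u v w K rho : R) (z : R -> V).

(** Differentiability at c relative to [a, b], stated for intervals that contain c and not for
    quotients based at c: this is the shape that [cousin] consumes, and at an endpoint it is the
    one-sided derivative. *)
Definition tagged_deriv a b z c (l : V) := forall e, 0 < e ->
  exists2 d, 0 < d & forall u v, a <= u -> u <= c -> c <= v -> v <= b ->
    v - u < d -> `|z v - z u - (v - u) *: l| <= e * (v - u).

Lemma tagged_deriv_sub a b a' b' z c l : a <= a' -> b' <= b ->
  tagged_deriv a b z c l -> tagged_deriv a' b' z c l.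
Proof.
move=> aa bb H e e0; have [d d0 Hd] := H e e0.
by exists d => // u v *; apply: Hd => //; lra.
Qed.

Lemma tagged_deriv_cst a b (x : V) c : tagged_deriv a b (fun=> x) c 0.
Proof.
move=> e e0; exists 1 => // u v au uc cv vb vu.
by rewrite subrr scaler0 subr0 normr0 mulr_ge0 ?(ltW e0)//; lra.
Qed.

Lemma tagged_deriv_lin a b (x : V) c : tagged_deriv a b (fun r => r *: x) c x.
Proof.
move=> e e0; exists 1 => // u v au uc cv vb vu.
by rewrite scalerBl subrr normr0 mulr_ge0 ?(ltW e0)//; lra.
Qed.

Lemma tagged_derivD a b z1 z2 c l1 l2 :
  tagged_deriv a b z1 c l1 -> tagged_deriv a b z2 c l2 ->
  tagged_deriv a b (fun r => z1 r + z2 r) c (l1 + l2).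
Proof.
move=> H1 H2 e e0; have e20 : 0 < e / 2 by rewrite divr_gt0.
have [d1 d10 Hd1] := H1 _ e20; have [d2 d20 Hd2] := H2 _ e20.
exists (Num.min d1 d2); first by rewrite lt_min d10.
move=> u v au uc cv vb; rewrite lt_min => /andP[vu1 vu2].
have {}Hd1 := Hd1 u v au uc cv vb vu1.
have {}Hd2 := Hd2 u v au uc cv vb vu2.
have -> : z1 v + z2 v - (z1 u + z2 u) - (v - u) *: (l1 + l2) =
  (z1 v - z1 u - (v - u) *: l1) + (z2 v - z2 u - (v - u) *: l2).
  by lmod R.
by apply: (le_trans (ler_normD _ _)); lra.
Qed.

Lemma tagged_derivZ a b z c l k : tagged_deriv a b z c l ->
  tagged_deriv a b (fun r => k *: z r) c (k *: l).
Proof.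
move=> H e e0; have k0 : 0 < `|k| + 1 by rewrite ltr_wpDl.
have [d d0 Hd] := H (e / (`|k| + 1)) (divr_gt0 e0 k0).
exists d => // u v au uc cv vb vu; have {}Hd := Hd u v au uc cv vb vu.
rewrite scalerA [(v - u) * k]mulrC -scalerA -!scalerBr normrZ.
apply: (le_trans (ler_wpM2l _ Hd)) => //.
have uv : 0 <= v - u by lra.
rewrite mulrA ler_wpM2r// mulrA ler_pdivrMr//; lra.
Qed.

Lemma tagged_derivB a b z1 z2 c l1 l2 :
  tagged_deriv a b z1 c l1 -> tagged_deriv a b z2 c l2 ->
  tagged_deriv a b (fun r => z1 r - z2 r) c (l1 - l2).
Proof.
move=> H1 /(tagged_derivZ (-1)) H2; have := tagged_derivD H1 H2.
by rewrite scaleN1r; under eq_fun do rewrite scaleN1r.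
Qed.

Lemma tagged_deriv_continuous a b z c l : tagged_deriv a b z c l ->
  forall e, 0 < e -> exists2 d, 0 < d & forall u v,
    a <= u -> u <= c -> c <= v -> v <= b -> v - u < d -> `|z v - z u| <= e.
Proof.
move=> H e e0; have [d d0 Hd] := H 1 ltr01.
have l0 : 0 < 1 + `|l| by rewrite ltr_pwDl.
exists (Num.min d (e / (1 + `|l|))); first by rewrite lt_min d0 divr_gt0.
move=> u v au uc cv vb; rewrite lt_min => /andP[vu].
rewrite ltr_pdivlMr// => vue.
have {}Hd := Hd u v au uc cv vb vu.
rewrite -[z v - z u](subrK ((v - u) *: l)).
apply: (le_trans (ler_normD _ _)); rewrite normrZ ger0_norm; last lra.
by rewrite mul1r in Hd; lra.
Qed.

(** The slack g = e - e0 pays for the o(v - u) error of each tagged step; the remaining growth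
    factor 1 + K (v - u) is at most exp (K (v - u)), the growth of the majorant [B]. *)
Lemma gronwall_slack a b K e0 e rho z : a <= b -> 0 <= K -> 0 <= e0 -> e0 < e ->
  (forall c, a <= c -> c <= b -> exists2 l, tagged_deriv a b z c l &
     `|z c| < rho -> `|l| <= K * `|z c| + e0) ->
  expR (K * (b - a)) * (`|z a| + e * (b - a)) < rho ->
  `|z b| <= expR (K * (b - a)) * (`|z a| + e * (b - a)).
Proof.
move=> ab K0 e00 e0e zl small.
have ep : 0 < e by exact: le_lt_trans e0e.
pose g := e - e0; have g0 : 0 < g by rewrite subr_gt0.
pose B r := expR (K * (r - a)) * (`|z a| + e * (r - a)).
have BB r : a <= r -> r <= b -> B r <= B b.
  move=> ar rb; apply: ler_pM; first exact: expR_ge0.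
  - by rewrite addr_ge0// mulr_ge0 ?(ltW ep)//; lra.
  - by rewrite ler_expR ler_wpM2l//; lra.
  - by rewrite lerD2l ler_wpM2l ?(ltW ep)//; lra.
suff : `|z a| <= B a -> `|z b| <= B b.
  by apply; rewrite /B subrr !mulr0 expR0 mul1r addr0.
(* The predicate is an implication between the bounds at both ends, hence transitive for free. *)
apply: (@cousin _ (fun u v => `|z u| <= B u -> `|z v| <= B v)) => //.
  by move=> u v w _ _ _ _ uv vw /uv /vw.
move=> c ac cb; have [l dl lz] := zl c ac cb.
have K1 : 0 < 4 * (K + 1) by lra.
(* The first entry keeps |z c| below rho, so that the bound on l applies at the tag; the second
   keeps K * eta below g / 4. *)
pose eta := Num.min (rho - B b) (g / (4 * (K + 1))).
have eta0 : 0 < eta by rewrite lt_min divr_gt0 ?andbT ?subr_gt0.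
have [d1 d10 Hd1] := tagged_deriv_continuous dl (divr_gt0 eta0 (ltr0n _ 2)).
have [d2 d20 Hd2] := dl (g / 4) (divr_gt0 g0 (ltr0n _ 4)).
exists (Num.min d1 d2); first by rewrite lt_min d10.
move=> u v au uc cv vb; rewrite lt_min => /andP[vu1 vu2] zu.
have uv0 : 0 <= v - u by lra.
have cu : `|z c - z u| <= eta / 2 by apply: Hd1 => //; lra.
have zc : `|z c| <= `|z u| + eta / 2.
  by rewrite -[z c](subrK (z u)) (le_trans (ler_normD _ _))//; lra.
have etaB : eta <= rho - B b by rewrite ge_min lexx.
have etae : K * eta <= g / 4.
  have : eta <= g / (4 * (K + 1)) by rewrite ge_min lexx orbT.
  rewrite ler_pdivlMr// => h.
  have : 0 <= eta by exact: ltW.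
  by nra.
have Bu := BB u au (le_trans uc cb).
have {lz}lz : `|l| <= K * `|z u| + e0 + g / 8.
  have lt : `|z c| < rho by lra.
  apply: (le_trans (lz lt)).
  have := ler_wpM2l K0 zc; lra.
have {}Hd2 := Hd2 u v au uc cv vb vu2.
have zv : `|z v| <= `|z u| + (v - u) * (K * `|z u| + e).
  have -> : z v = z u + (v - u) *: l + (z v - z u - (v - u) *: l).
    by lmod R.
  apply: (le_trans (ler_normD _ _)).
  have := ler_normD (z u) ((v - u) *: l).
  rewrite normrZ (ger0_norm uv0).
  have := ler_wpM2l uv0 lz.
  have : 0 <= g * (v - u) by rewrite mulr_ge0 ?(ltW g0).
  have -> : e = e0 + g by rewrite /g; lra.
  clearbody g; lra.
have ek : 1 + K * (v - u) <= expR (K * (v - u)) by exact: expR_ge1Dx.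
have ek1 : 1 <= expR (K * (v - u)).
  by apply: le_trans ek; rewrite lerDl mulr_ge0.
have eu1 : 1 <= expR (K * (u - a)).
  by rewrite -expR0 ler_expR mulr_ge0//; lra.
apply: (le_trans zv).
have -> : B v = expR (K * (v - u)) *
    (B u + expR (K * (u - a)) * (e * (v - u))).
  rewrite /B -mulrDr mulrA -expRD.
  by congr (expR _ * _); ring.
apply: (@le_trans _ _ (expR (K * (v - u)) * (`|z u| + e * (v - u)))).
  have h1 := ler_wpM2r (normr_ge0 (z u)) ek.
  have ev : 0 <= e * (v - u) by rewrite mulr_ge0 ?(ltW ep).
  have h2 := ler_wpM2r ev ek1.
  rewrite mulrDr; lra.
rewrite ler_wpM2l ?expR_ge0// lerD// ler_peMl// mulr_ge0 ?(ltW ep)//.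
Qed.

(* The a priori bound on the derivative is only required where |z| < rho: the
   conclusion itself keeps z in that region. *)
Lemma gronwall a b K e rho z : a <= b -> 0 <= K -> 0 <= e ->
  (forall c, a <= c -> c <= b -> exists2 l, tagged_deriv a b z c l &
     `|z c| < rho -> `|l| <= K * `|z c| + e) ->
  expR (K * (b - a)) * (`|z a| + e * (b - a)) < rho ->
  forall r, a <= r -> r <= b ->
  `|z r| <= expR (K * (r - a)) * (`|z a| + e * (r - a)).
Proof.
move=> ab K0 e0 zl small r ar rb.
have rho_r : expR (K * (r - a)) * (`|z a| + e * (r - a)) < rho.
  apply: le_lt_trans small; apply: ler_pM; first exact: expR_ge0.
  - by rewrite addr_ge0// mulr_ge0//; lra.
  - by rewrite ler_expR ler_wpM2l//; lra.
  - by rewrite lerD2l ler_wpM2l//; lra.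
set B := _ * _ in rho_r *; pose C := expR (K * (r - a)) * (r - a) + 1.
have C0 : 0 < C by rewrite ltr_wpDl// mulr_ge0 ?expR_ge0//; lra.
apply/ler_addgt0Pr => eta eta0.
(* This slack raises the bound by at most s * C, half of the smaller of the tolerance eta and the
   room rho - B, so the bound stays below rho. *)
pose s := Num.min eta (rho - B) / (2 * C).
have s0 : 0 < s by rewrite divr_gt0 ?mulr_gt0// lt_min eta0 subr_gt0.
have sC : s * C = Num.min eta (rho - B) / 2.
  by rewrite /s invfM mulrA mulfVK// gt_eqF.
have BC : expR (K * (r - a)) * (`|z a| + (e + s) * (r - a)) <= B + s * C.
  by rewrite /B /C; nra.
have m1 : Num.min eta (rho - B) <= eta by rewrite ge_min lexx.
have m2 : Num.min eta (rho - B) <= rho - B by rewrite ge_min lexx orbT.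
have m0 : 0 < Num.min eta (rho - B) by rewrite lt_min eta0 subr_gt0.
apply: le_trans (_ : B + s * C <= _); last by rewrite sC; lra.
apply: le_trans (BC); apply: (@gronwall_slack _ _ _ e _ rho) => //.
- by rewrite ltrDl.
- move=> c ac cr; have [l dl lK] := zl c ac (le_trans cr rb).
  by exists l => //; exact: tagged_deriv_sub dl.
- by apply: le_lt_trans (BC) _; rewrite sC; lra.
Qed.

End tagged_derivative.

(** * Fréchet derivatives and the mean value inequality *)

Section differential_estimates.
Context (R : realType) (V : completeNormedModType R).
Implicit Types (F : V -> V) (L : {linear V -> V}).

Lemma differentiable_bound F x : differentiable F x ->
  exists2 K, 0 < K & forall h, `|'d F x h| <= K * `|h|.
Proof.
move=> /diff_continuous/linear_bounded_continuous/linear_boundedP.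
by move=> /pinfty_ex_gt0[K K0 HK]; exists K.
Qed.

Lemma differentiable_eps F x : differentiable F x ->
  forall e, 0 < e -> exists2 d, 0 < d & forall h, `|h| < d ->
    `|F (x + h) - F x - 'd F x h| <= e * `|h|.
Proof.
move=> /diff_locally/eqaddoP H e e0.
have /nbhs_normP[d /= d0 Hd] := H _ e0.
exists d => // h hd; have := Hd h; rewrite /= sub0r normrN => /(_ hd).
rewrite -[(_ - _ : V -> V) h]/(F (h + x) - (F x + 'd F x h)).
by rewrite opprD addrA [h + x]addrC.
Qed.

Lemma differentiable_of_eps F x L K : (forall h, `|L h| <= K * `|h|) ->
  (forall e, 0 < e -> exists2 d, 0 < d & forall h, `|h| < d ->
    `|F (x + h) - F x - L h| <= e * `|h|) ->
  differentiable F x /\ ('d F x : V -> V) = L.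
Proof.
move=> LK H.
have Lc : continuous L.
  apply/linear_bounded_continuous/linear_boundedP.
  exists K; split; first exact: num_real.
  by move=> r Kr h; apply: (le_trans (LK h)); rewrite ler_wpM2r// ltW.
have FL : F \o shift x = cst (F x) + L +o_ 0 id.
  apply/eqaddoP => e e0; have [d d0 Hd] := H e e0.
  apply/nbhs_normP; exists d => // h /=; rewrite sub0r normrN => hd.
  rewrite -[(_ - _ : V -> V) h]/(F (h + x) - (F x + L h)).
  by rewrite opprD addrA [h + x]addrC; exact: Hd.
have dL := diff_unique Lc FL.
by split => //; apply/diff_locallyP; rewrite dL.
Qed.

(** The bound K makes the set in [opnorm] bounded above, so that its [sup] is a supremum and not the
    default 0; the vector h / |h| is then a test point. *)
Lemma opnorm_bound (A : V -> V) K :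
  (forall h, `|A h| <= K * `|h|) ->
  (forall k h, A (k *: h) = k *: A h) ->
  forall h, `|A h| <= opnorm A * `|h|.
Proof.
move=> AK AZ h.
have [->|h0] := eqVneq h 0.
  by have := AK 0; rewrite !normr0 !mulr0.
have nh : 0 < `|h| by rewrite normr_gt0.
rewrite -ler_pdivrMr// mulrC -[X in X * _]ger0_norm ?invr_ge0//.
rewrite -normrZ -AZ; apply: ub_le_sup.
  exists (Num.max K 0) => _ [x /= x1 <-]; apply: (le_trans (AK x)).
  have : K <= Num.max K 0 by rewrite le_max lexx.
  have : 0 <= Num.max K 0 by rewrite le_max lexx orbT.
  have := normr_ge0 x; move: x1; move: `|x| (Num.max K 0) => t M; nra.
exists (`|h|^-1 *: h) => //=.
by rewrite normrZ normfV normr_id mulVf// gt_eqF.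
Qed.

Lemma tagged_deriv_line F (x h : V) (c : R) : differentiable F (x + c *: h) ->
  tagged_deriv 0 1 (fun r => F (x + r *: h)) c ('d F (x + c *: h) h).
Proof.
move=> dF e e0.
have h0 : 0 < `|h| + 1 by rewrite ltr_wpDl.
have [d d0 Hd] := differentiable_eps dF (divr_gt0 e0 h0).
exists (d / (`|h| + 1)); first by rewrite divr_gt0.
move=> u v _ uc cv _; rewrite ltr_pdivlMr// => vu.
have key w : `|w - c| <= v - u ->
    `|F (x + w *: h) - F (x + c *: h) - (w - c) *: 'd F (x + c *: h) h|
      <= e * `|w - c|.
  move=> wc; have -> : x + w *: h = (x + c *: h) + (w - c) *: h by lmod R.
  rewrite -linearZ/=; apply: le_trans (Hd _ _) _.
    rewrite normrZ; apply: le_lt_trans vu.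
    by apply: ler_pM => //; rewrite lerDl.
  rewrite normrZ mulrCA [e * `|w - c|]mulrC ler_wpM2l// mulrAC ler_pdivrMr// ler_pM2l//.
  by rewrite lerDl.
(* As u <= c <= v, the two errors add up to a multiple of (v - c) + (c - u) = v - u. *)
have := key u; have := key v; rewrite (@ger0_norm _ (v - c)); last lra.
rewrite (@ler0_norm _ (u - c)); last lra.
move=> /(_ ltac:(lra)) kv /(_ ltac:(lra)) ku.
set l := 'd F (x + c *: h) h in kv ku *.
have -> : F (x + v *: h) - F (x + u *: h) - (v - u) *: l =
  (F (x + v *: h) - F (x + c *: h) - (v - c) *: l) -
  (F (x + u *: h) - F (x + c *: h) - (u - c) *: l) by lmod R.
by apply: (le_trans (ler_normB _ _)); lra.
Qed.

(** Gronwall with K = 0 along the segment from x' to x: the defect [z] starts at 0 and its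
    derivative has norm at most e |x - x'|. In the application L is the derivative of f at another
    time. *)
Lemma mean_value F L (y : V) d e : 0 <= e ->
  (forall x, `|x - y| < d -> differentiable F x /\
     forall h, `|'d F x h - L h| <= e * `|h|) ->
  forall x x', `|x - y| < d -> `|x' - y| < d ->
  `|F x - F x' - L (x - x')| <= e * `|x - x'|.
Proof.
move=> e0 HF x x' xy x'y; pose h := x - x'.
pose z r := F (x' + r *: h) - F x' - r *: L h.
have := @gronwall R V 0 1 0 (e * `|h|) (e * `|h| + 1) z ler01 (lexx 0).
have z0 : z 0 = 0 by rewrite /z !scale0r addr0 subrr subr0.
have z1 : z 1 = F x - F x' - L h.
  by rewrite /z !scale1r /h addrCA subrr addr0.
rewrite z0 normr0 mul0r expR0 mul1r add0r subr0 mulr1 ltrDl ltr01.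
rewrite mulr_ge0// => /(_ isT) H; have {}H := H _ isT 1 ler01 (lexx 1).
rewrite z1 subr0 mul0r expR0 add0r mul1r mulr1 in H; apply: H.
move=> c c0 c1.
have cd : `|(x' + c *: h) - y| < d.
  have -> : x' + c *: h - y = (1 - c) *: (x' - y) + c *: (x - y).
    by rewrite /h; lmod R.
  apply: le_lt_trans (ler_normD _ _) _.
  rewrite !normrZ !ger0_norm//; last lra.
  have m : Num.max `|x' - y| `|x - y| < d by rewrite gt_max x'y.
  apply: le_lt_trans m.
  have : `|x' - y| <= Num.max `|x' - y| `|x - y| by rewrite le_max lexx.
  have : `|x - y| <= Num.max `|x' - y| `|x - y| by rewrite le_max lexx orbT.
  move: (Num.max _ _) => m; move: `|x' - y| `|x - y| => s t; nra.
have [dF dFL] := HF _ cd.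
exists ('d F (x' + c *: h) h - L h); last by rewrite mul0r add0r dFL.
rewrite -['d F _ h]subr0; apply: tagged_derivB; last exact: tagged_deriv_lin.
by apply: tagged_derivB; [exact: tagged_deriv_line|exact: tagged_deriv_cst].
Qed.

End differential_estimates.

(** * Limits in a complete normed space *)

Section limits.
Context (R : realType) (V : completeNormedModType R).

Lemma norm_le_eps_eq0 (x : V) (M : R) : (forall e : R, 0 < e -> `|x| <= e * M) -> x = 0.
Proof.
move=> H; apply/eqP; rewrite -normr_le0; apply/ler_addgt0Pr => e e0.
have M1 : 0 < `|M| + 1 by rewrite ltr_wpDl.
rewrite add0r; apply: le_trans (H (e / (`|M| + 1)) _) _; first by rewrite divr_gt0.
rewrite mulrAC ler_pdivrMr// ler_wpM2l ?(ltW e0)//.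
by rewrite (le_trans (ler_norm M))// lerDl.
Qed.

Lemma cvgn_of_cauchy (u : nat -> V) :
  (forall e : R, 0 < e -> exists N, forall n, (N <= n)%N -> `|u N - u n| < e) ->
  cvgn u.
Proof.
move=> H; apply/cauchy_cvgP; apply: cauchy_exP => e e0.
have [N HN] := H e e0; exists (u N); exists N => // n /= Nn.
by rewrite -ball_normE; exact: HN.
Qed.

Lemma cvgn_norm_le (u : nat -> V) (l x : V) (M : R) : u @ \oo --> l ->
  (\forall n \near \oo, `|u n - x| <= M) -> `|l - x| <= M.
Proof.
move=> ul uM; apply/ler_addgt0Pr => e e0.
have /cvgrPdist_lt/(_ e e0) ule := ul.
near \oo => n.
have -> : l - x = (u n - x) + (l - u n) by lmod R.
apply: (le_trans (ler_normD _ _)); apply: lerD; first by near: n.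
by apply: ltW; near: n.
Unshelve. all: by end_near. Qed.

End limits.

(** Constants of [flow_almost_linear]: C bounds a Gronwall factor, n the defect at the common time,
    g the time left. Each of the two summands costs at most e * w / 2. *)
Lemma almost_linear_budget (R : realType) (T C e e2 w n g : R) : 0 < C -> 0 < e ->
  e2 <= e / (4 * C) -> 0 <= w -> 0 <= T -> g <= T -> n <= 2 * e2 * w ->
  C * (n + e / (8 * C * C * (T + 1)) * (4 * C * w) * g) <= e * w.
Proof.
move=> C0 e0 e2e w0 T0 gT nw.
have T1 : 0 < T + 1 by move: T0; clear; lra.
have -> : C * (n + e / (8 * C * C * (T + 1)) * (4 * C * w) * g) =
    C * n + e / 2 * w * (g / (T + 1)).
  by field; rewrite !gt_eqF.
have gT1 : g / (T + 1) <= 1.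
  by rewrite ler_pdivrMr// mul1r; move: gT; clear; lra.
have ew : 0 <= e / 2 * w by rewrite mulr_ge0// divr_ge0// ltW.
have h1 := ler_wpM2l ew gT1.
have h2 := ler_wpM2l (ltW C0) nw.
have h3 : C * (2 * (e / (4 * C)) * w) = e / 2 * w by field; rewrite gt_eqF.
have h4 : C * (2 * e2 * w) <= C * (2 * (e / (4 * C)) * w).
  by rewrite ler_wpM2l ?(ltW C0)// ler_wpM2r// ler_wpM2l.
by move: h1 h2 h3 h4; clear; lra.
Qed.

(** * Differentiability of the flow *)

Section flow.
Context (R : realType) (V : completeNormedModType R) (T : R) (f : R -> V -> V).
Implicit Types (a b c d e r s t u v w K rho k l C : R) (x y z h : V).
Context (f_diff : forall t, 0 <= t -> t <= T -> forall x, differentiable (f t) x).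
Context (f_cont : forall c y, 0 <= c -> c <= T -> forall e, 0 < e ->
  exists2 d, 0 < d & forall r x, 0 <= r -> r <= T -> `|r - c| < d ->
    `|x - y| < d -> `|f r x - f c y| <= e).
Context (df_cont : forall c y, 0 <= c -> c <= T -> forall e, 0 < e ->
  exists2 d, 0 < d & forall r x, 0 <= r -> r <= T -> `|r - c| < d ->
    `|x - y| < d -> forall h, `|'d (f r) x h - 'd (f c) y h| <= e * `|h|).

Ltac clear_local := clear - f_diff f_cont df_cont.

Lemma strict_differentiable c y : 0 <= c -> c <= T -> forall e, 0 < e ->
  exists2 d, 0 < d & forall r x x', 0 <= r -> r <= T -> `|r - c| < d ->
    `|x - y| < d -> `|x' - y| < d ->
    `|f r x - f r x' - 'd (f c) y (x - x')| <= e * `|x - x'|.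
Proof.
move=> c0 cT e e0; have [d d0 Hd] := df_cont y c0 cT e0.
exists d => // r x x' r0 rT rc; apply: (mean_value (ltW e0)) => x1 x1y.
by split; [exact: f_diff | exact: Hd].
Qed.

(* Strict differentiability of f r near x0, phrased without the derivative; when
   e shrinks only rho changes, not K. *)
Definition tube K e rho r x0 := forall k l x1 x1' x2 x2',
  `|x1 - x0| < rho -> `|x1' - x0| < rho -> `|x2 - x0| < rho ->
  `|x2' - x0| < rho ->
  `|k *: (f r x1 - f r x1') - l *: (f r x2 - f r x2')| <=
  K * `|k *: (x1 - x1') - l *: (x2 - x2')| +
  e * (`|k *: (x1 - x1')| + `|l *: (x2 - x2')|).

Lemma tube_lipschitz K e rho r x0 : tube K e rho r x0 ->
  forall x x', `|x - x0| < rho -> `|x' - x0| < rho ->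
  `|f r x - f r x'| <= (K + e) * `|x - x'|.
Proof.
move=> H x x' xr xr'; have := H 1 0 x x' x x' xr xr' xr xr'.
by rewrite !scale0r !scale1r !subr0 normr0 addr0 mulrDl.
Qed.

Lemma tubeW K K' e e' rho rho' r x0 : K <= K' -> e <= e' -> rho' <= rho ->
  tube K e rho r x0 -> tube K' e' rho' r x0.
Proof.
move=> KK ee rr H k l x1 x1' x2 x2' h1 h1' h2 h2'.
apply: (le_trans (H k l x1 x1' x2 x2' _ _ _ _)); try exact: lt_le_trans rr.
by rewrite lerD// ler_wpM2r// addr_ge0.
Qed.

(** The linear map ['d (f c) y] commutes with the combination by k and l, so putting it in place of
    f r costs only the errors of strict differentiability, and K bounds this map alone, whatever e
    is. Halving the radius gives uniformity in the centre x0. *)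
Lemma local_tube c y K : 0 <= c -> c <= T ->
  (forall h, `|'d (f c) y h| <= K * `|h|) -> forall e, 0 < e ->
  exists2 d, 0 < d & forall r x0, 0 <= r -> r <= T -> `|r - c| < d ->
    `|x0 - y| < d -> tube K e d r x0.
Proof.
move=> c0 cT AK e e0; have [d d0 Hd] := strict_differentiable y c0 cT e0.
exists (d / 2); first by rewrite divr_gt0.
move=> r x0 r0 rT rc x0y k l x1 x1' x2 x2' h1 h1' h2 h2'.
have near_y x : `|x - x0| < d / 2 -> `|x - y| < d.
  move=> h; have -> : x - y = (x - x0) + (x0 - y) by lmod R.
  by apply: le_lt_trans (ler_normD _ _) _; lra.
have rd : `|r - c| < d by lra.
have H1 := Hd r x1 x1' r0 rT rd (near_y _ h1) (near_y _ h1').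
have H2 := Hd r x2 x2' r0 rT rd (near_y _ h2) (near_y _ h2').
set A := 'd (f c) y in AK H1 H2.
have -> : k *: (f r x1 - f r x1') - l *: (f r x2 - f r x2') =
  A (k *: (x1 - x1') - l *: (x2 - x2')) +
  (k *: (f r x1 - f r x1' - A (x1 - x1')) -
   l *: (f r x2 - f r x2' - A (x2 - x2'))).
  have -> : A (k *: (x1 - x1') - l *: (x2 - x2')) =
    k *: A (x1 - x1') - l *: A (x2 - x2') by rewrite linearB !linearZ.
  by lmod R.
apply: (le_trans (ler_normD _ _)); rewrite lerD// (le_trans (ler_normB _ _))//.
rewrite !normrZ mulrDr; apply: lerD; rewrite mulrCA ler_wpM2l//.
Qed.

(** Cousin's lemma stands in for compactness of the path. It runs twice because K must be fixed
    before e: once to bound the derivatives along the path, then for every e to find a radius. *)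
Lemma path_tube a b (p : R -> V) : 0 <= a -> a <= b -> b <= T ->
  (forall c, a <= c -> c <= b -> forall e, 0 < e -> exists2 d, 0 < d &
     forall r, a <= r -> r <= b -> `|r - c| < d -> `|p r - p c| < e) ->
  exists2 K, 0 < K & forall e, 0 < e -> exists2 rho, 0 < rho &
    forall r, a <= r -> r <= b -> tube K e rho r (p r).
Proof.
move=> a0 ab bT pc.
have [K K0 HK] : exists2 K, 0 < K & forall r, a <= r -> r <= b -> forall h,
    `|'d (f r) (p r) h| <= K * `|h|.
  pose P u v := exists2 K, 0 < K & forall r, u <= r -> r <= v ->
    forall h, `|'d (f r) (p r) h| <= K * `|h|.
  apply: (@cousin _ P) => // [u v w _ uv vw _ [K K0 HK] [K' K'0 HK']|c ac cb].
    exists (K + K'); first by rewrite addr_gt0.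
    move=> r ur rw h; rewrite mulrDl.
    have [rv|/ltW vr] := leP r v.
      by rewrite ler_wpDr ?HK// mulr_ge0// ltW.
    by rewrite ler_wpDl ?HK'// mulr_ge0// ltW.
  have c0 : 0 <= c by lra.
  have cT : c <= T by lra.
  have [K K0 HK] := differentiable_bound (f_diff c0 cT (p c)).
  have [d d0 Hd] := df_cont (p c) c0 cT ltr01.
  have [d' d'0 Hd'] := pc c ac cb d d0.
  exists (Num.min d d'); first by rewrite lt_min d0.
  move=> u v au uc cv vb; rewrite lt_min => /andP[vud vud'].
  exists (K + 1); first by rewrite addr_gt0.
  move=> r ur rv h.
  have rc : `|r - c| <= v - u by rewrite ler_norml; lra.
  have {}Hd := Hd r (p r) _ _ (le_lt_trans rc vud) (Hd' r _ _ (le_lt_trans rc vud')) h.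
  rewrite -['d (f r) (p r) h](subrK ('d (f c) (p c) h)).
  apply: le_trans (ler_normD _ _) _; rewrite addrC mulrDl lerD//.
  by apply: Hd; lra.
exists K => // e e0.
pose P u v := exists2 rho, 0 < rho & forall r, u <= r -> r <= v ->
  tube K e rho r (p r).
apply: (@cousin _ P) => // [u v w _ uv vw _ [d d0 Hd] [d' d'0 Hd']|c ac cb].
  exists (Num.min d d'); first by rewrite lt_min d0.
  move=> r ur rw; have [rv|/ltW vr] := leP r v.
    by apply: (tubeW _ _ _ (Hd r ur rv)) => //; rewrite ge_min lexx.
  by apply: (tubeW _ _ _ (Hd' r vr rw)) => //; rewrite ge_min lexx orbT.
have [||d d0 Hd] := local_tube _ _ (HK c ac cb) e0; [lra..|].
have [d' d'0 Hd'] := pc c ac cb d d0.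
exists (Num.min d d'); first by rewrite lt_min d0.
move=> u v au uc cv vb; rewrite lt_min => /andP[vud vud'].
exists d => // r ur rv.
have rc : `|r - c| <= v - u by rewrite ler_norml; lra.
apply: Hd; [lra|lra|exact: le_lt_trans vud|].
by apply: Hd'; [lra|lra|exact: le_lt_trans vud'].
Qed.

Context (X : R -> R -> V -> V).
Context (X_deriv : forall s x c, 0 <= s -> s <= c -> c <= T ->
  tagged_deriv s T (fun r => X s r x) c (f c (X s c x))).
Context (X_start : forall s x, 0 <= s -> s <= T -> X s s x = x).

Ltac clear_local ::= clear - f_diff f_cont df_cont X_deriv X_start.

Lemma solution_continuous s x c : 0 <= s -> s <= c -> c <= T ->
  forall e, 0 < e -> exists2 d, 0 < d & forall r, s <= r -> r <= T ->
    `|r - c| < d -> `|X s r x - X s c x| < e.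
Proof.
move=> s0 sc cT e e0; have e20 : 0 < e / 2 by rewrite divr_gt0.
have [d d0 Hd] := tagged_deriv_continuous (X_deriv x s0 sc cT) e20.
exists d => // r sr rT rc; apply: (@le_lt_trans _ _ (e / 2)); last lra.
have [cr|/ltW rc'] := leP c r.
  by apply: Hd => //; rewrite ger0_norm in rc => //; lra.
rewrite distrC; apply: Hd => //.
by rewrite ler0_norm in rc => //; lra.
Qed.

Lemma gronwall_simple a b K e (z : R -> V) : a <= b -> 0 <= K -> 0 <= e ->
  (forall c, a <= c -> c <= b -> exists2 l, tagged_deriv a b z c l &
     `|l| <= K * `|z c| + e) ->
  forall r, a <= r -> r <= b ->
  `|z r| <= expR (K * (r - a)) * (`|z a| + e * (r - a)).
Proof.
move=> ab K0 e0 Hz.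
apply: (@gronwall _ _ _ _ _ _ (expR (K * (b - a)) * (`|z a| + e * (b - a)) + 1)
  _ ab K0 e0) => [c ac cb|]; last by rewrite ltrDl.
by have [l zl lK] := Hz c ac cb; exists l.
Qed.

Lemma solution_deriv a b s x c : 0 <= s -> s <= a -> b <= T -> a <= c ->
  c <= b -> tagged_deriv a b (fun r => X s r x) c (f c (X s c x)).
Proof.
move=> s0 sa bT ac cb; apply: (tagged_deriv_sub sa bT).
by apply: X_deriv => //; lra.
Qed.

(** The ball of radius rho around the reference solution is the a priori region of [gronwall]: a
    second solution close enough at time v cannot leave it, since the bound stays below rho up to
    time t. *)
Lemma solutions_close u x v t K rho : 0 <= u -> u <= v -> v <= t -> t <= T ->
  0 <= K -> (forall r, v <= r -> r <= t -> forall x1 x2,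
    `|x1 - X u r x| < rho -> `|x2 - X u r x| < rho ->
    `|f r x1 - f r x2| <= K * `|x1 - x2|) ->
  forall s y, 0 <= s -> s <= v ->
  expR (K * (t - v)) * `|X s v y - X u v x| < rho ->
  forall r, v <= r -> r <= t ->
  `|X s r y - X u r x| <= expR (K * (r - v)) * `|X s v y - X u v x|.
Proof.
move=> u0 uv vt tT K0 lip s y s0 sv small r vr rt.
have := @gronwall R V v t K 0 rho (fun r => X s r y - X u r x) vt K0 (lexx 0).
rewrite mul0r addr0 => H; have := H _ small r vr rt.
rewrite mul0r addr0; apply => c vc ct.
have rho0 : 0 < rho by apply: le_lt_trans small; rewrite mulr_ge0// expR_ge0.
exists (f c (X s c y) - f c (X u c x)).
  by apply: tagged_derivB; exact: solution_deriv.
by move=> zc; rewrite addr0 lip// subrr normr0.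
Qed.

Lemma solution_tube u x v t : 0 <= u -> u <= v -> v <= t -> t <= T ->
  exists2 K, 0 < K & forall e, 0 < e -> exists2 rho, 0 < rho &
    forall r, v <= r -> r <= t -> tube K e rho r (X u r x).
Proof.
move=> u0 uv vt tT; apply: path_tube => //; first by lra.
move=> c vc ct e e0.
have [||d d0 Hd] := @solution_continuous u x c u0 _ _ e e0; [lra..|].
by exists d => // r vr rt rc; apply: Hd => //; lra.
Qed.

(** Uniqueness of solutions: both sides continue the value X u v x from time v, so Gronwall starts
    from a zero difference. *)
Lemma flow_property u v t x : 0 <= u -> u <= v -> v <= t -> t <= T ->
  X v t (X u v x) = X u t x.
Proof.
move=> u0 uv vt tT.
have [K K0 /(_ 1 ltr01)[rho rho0 HK]] := solution_tube x u0 uv vt tT.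
have K10 : 0 <= K + 1 by lra.
have := @solutions_close u x v t (K + 1) rho u0 uv vt tT K10.
have lip r : v <= r -> r <= t -> forall x1 x2,
    `|x1 - X u r x| < rho -> `|x2 - X u r x| < rho ->
    `|f r x1 - f r x2| <= (K + 1) * `|x1 - x2|.
  by move=> vr rt; exact: tube_lipschitz (HK r vr rt).
move=> /(_ lip v (X u v x) (le_trans u0 uv) (lexx v)).
rewrite X_start; [|lra|lra]; rewrite subrr normr0 mulr0.
move=> /(_ rho0 t vt (lexx t)); rewrite mulr0 normr_le0 subr_eq0.
by move/eqP.
Qed.

(** One Euler step, uniform in the initial time and the starting point. In [gronwall] with K = 0,
    the region |z| < d / 4 keeps the solution within d of y, where f is within e of f c y. *)
Lemma flow_short_time c y : 0 <= c -> c <= T -> forall e, 0 < e ->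
  exists2 d, 0 < d & forall u v x, 0 <= u -> u <= v -> v <= T ->
    `|u - c| < d -> `|v - c| < d -> `|x - y| < d ->
    `|X u v x - x - (v - u) *: f c y| <= e * (v - u).
Proof.
move=> c0 cT e e0; have [d d0 Hd] := f_cont y c0 cT e0.
set m := `|f c y|; have m0 : 0 <= m by exact: normr_ge0.
(* Makes d equal to 8 * d1 * (1 + m + e): a start within d1 of y and a duration below 2 * d1, at
   speed m and with error e, then fit into the ball of radius d. *)
pose k := 8 * (1 + m + e); have k0 : 0 < k by rewrite /k; lra.
pose d1 := d / k; have d10 : 0 < d1 by rewrite divr_gt0.
have dd1 : d = d1 * k by rewrite /d1 divfK// gt_eqF.
have dE : d = 8 * d1 + 8 * (d1 * m) + 8 * (d1 * e) by rewrite dd1 /k; ring.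
have d1m : 0 <= d1 * m by rewrite mulr_ge0// ltW.
have d1e : 0 < d1 * e by rewrite mulr_gt0.
exists d1 => // u v x u0 uv vT; rewrite !ltr_norml => /andP[cu1 cu2] /andP[cv1 cv2] xy.
have vu : v - u < 2 * d1 by lra.
have vum : (v - u) * m <= 2 * (d1 * m) by rewrite mulrA ler_wpM2r// ltW.
have evu : e * (v - u) <= 2 * (d1 * e).
  by rewrite [d1 * e]mulrC mulrCA ler_wpM2l ?(ltW e0)// ltW.
have := @gronwall R V u v 0 e (d / 4)
  (fun r => X u r x - x - (r - u) *: f c y) uv (lexx 0) (ltW e0).
rewrite subrr scale0r X_start//; last lra.
rewrite subr0 subrr normr0 mul0r expR0 mul1r add0r => H.
have := H _ _ v uv (lexx v); rewrite mul0r expR0 mul1r add0r; apply; last lra.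
move=> w uw wv.
exists (f w (X u w x) - 0 - (f c y - 0)); last first.
  rewrite !subr0 mul0r add0r => zw; apply: Hd; [lra|lra| |].
    by rewrite ltr_norml; lra.
  have -> : X u w x - y = (X u w x - x - (w - u) *: f c y) +
    ((x - y) + (w - u) *: f c y) by lmod R.
  apply: (le_lt_trans (ler_normD _ _)).
  have := ler_normD (x - y) ((w - u) *: f c y).
  rewrite normrZ (ger0_norm (_ : 0 <= w - u)); last lra.
  have : (w - u) * m <= (v - u) * m by rewrite ler_wpM2r//; lra.
  rewrite -/m; lra.
apply: tagged_derivB; first apply: tagged_derivB.
- exact: solution_deriv.
- exact: tagged_deriv_cst.
under eq_fun do rewrite scalerBl.
by apply: tagged_derivB; [exact: tagged_deriv_lin|exact: tagged_deriv_cst].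
Qed.

Lemma flow_stays_near c y : 0 <= c -> c <= T -> forall e, 0 < e ->
  exists2 d, 0 < d & forall u v x, 0 <= u -> u <= v -> v <= T ->
    `|u - c| < d -> `|v - c| < d -> `|x - y| < d -> `|X u v x - y| < e.
Proof.
move=> c0 cT e e0; have [d d0 Hd] := flow_short_time y c0 cT ltr01.
set m := `|f c y|; have m0 : 0 <= m by exact: normr_ge0.
pose k := 8 * (1 + m); have k0 : 0 < k by rewrite /k; lra.
pose d1 := e / k; have d10 : 0 < d1 by rewrite divr_gt0.
have eE : e = 8 * d1 + 8 * (d1 * m).
  by rewrite -[LHS](divfK (lt0r_neq0 k0)) -/d1 /k; ring.
exists (Num.min d d1); first by rewrite lt_min d0.
move=> u v x u0 uv vT; rewrite !lt_min => /andP[ud ud1] /andP[vd vd1] /andP[xd xd1].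
have {}Hd := Hd u v x u0 uv vT ud vd xd; rewrite mul1r in Hd.
have -> : X u v x - y = (X u v x - x - (v - u) *: f c y) +
    ((x - y) + (v - u) *: f c y) by lmod R.
apply: (le_lt_trans (ler_normD _ _)).
have := ler_normD (x - y) ((v - u) *: f c y).
rewrite normrZ (ger0_norm (_ : 0 <= v - u)) -/m; last lra.
have vu : v - u <= 2 * d1 by move: ud1 vd1; rewrite !ltr_norml; lra.
have : (v - u) * m <= 2 * (d1 * m) by rewrite mulrA ler_wpM2r.
have : 0 <= d1 * m by rewrite mulr_ge0// ltW.
lra.
Qed.

(** The defect [z] starts at 0 and, by the Lipschitz bound of a local tube, grows at rate at most (K
    + 1)(|z| + |x - x'|). The estimate serves to move two initial times to a common one. *)
Lemma flow_short_time_diff c y : 0 <= c -> c <= T -> forall e, 0 < e ->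
  exists2 d, 0 < d & forall u v x x', 0 <= u -> u <= v -> v <= T ->
    `|u - c| < d -> `|v - c| < d -> `|x - y| < d -> `|x' - y| < d ->
    `|X u v x - X u v x' - (x - x')| <= e * `|x - x'|.
Proof.
move=> c0 cT e e0.
have [K K0 HK] := differentiable_bound (f_diff c0 cT y).
have [d d0 Hd] := local_tube c0 cT HK ltr01.
have [d1 d10 Hd1] := flow_stays_near y c0 cT d0.
have K10 : 0 <= K + 1 by lra.
(* The 2 absorbs v - u <= |u - c| + |v - c|; since v - u <= 1, the Gronwall factor is at most exp (K
   + 1). *)
pose C := 2 * expR (K + 1) * (K + 1).
have C0 : 0 < C by rewrite !mulr_gt0// ?expR_gt0//; lra.
exists (Num.min (Num.min d d1) (Num.min (1 / 2) (e / C))).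
  by rewrite !lt_min d0 d10 divr_gt0//= divr_gt0.
move=> u v x x' u0 uv vT; rewrite !lt_min -!andbA.
move=> /and4P[ud ud1 u2 uC] /and4P[vd vd1 v2 vC] /and4P[_ xd1 _ _] /and4P[_ x'd1 _ _].
set z := fun r => X u r x - X u r x' - (x - x').
have zu : z u = 0 by rewrite /z !X_start ?subrr//; lra.
have vu1 : v - u <= 1 by move: u2 v2; rewrite !ltr_norml; lra.
have vuC : C * (v - u) <= 2 * e.
  have : `|u - c| * C < e by rewrite -ltr_pdivlMr.
  have : `|v - c| * C < e by rewrite -ltr_pdivlMr.
  have : C * (v - u) <= `|u - c| * C + `|v - c| * C.
    rewrite -mulrDl mulrC ler_wpM2r ?(ltW C0)//.
    have := ler_norm (v - c); have := ler_norm (c - u); rewrite distrC; lra.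
  lra.
have := @gronwall_simple u v (K + 1) ((K + 1) * `|x - x'|) z uv K10.
rewrite mulr_ge0// zu normr0 => /(_ isT) H.
have := H _ v uv (lexx v); rewrite add0r.
have E0 : 0 <= K + 1 by [].
have Eb : expR ((K + 1) * (v - u)) <= expR (K + 1).
  by rewrite ler_expR ler_piMr//; lra.
have P0 : 0 <= (K + 1) * `|x - x'| * (v - u) by rewrite !mulr_ge0//; lra.
rewrite -/(z v) => {}H; apply: le_trans (H _) _; last first.
  apply: le_trans (ler_wpM2r P0 Eb) _.
  have : C * (v - u) * `|x - x'| <= 2 * e * `|x - x'| by rewrite ler_wpM2r.
  rewrite /C; lra.
move=> w uw wv.
exists (f w (X u w x) - f w (X u w x') - 0).
  apply: tagged_derivB; last exact: tagged_deriv_cst.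
  by apply: tagged_derivB; exact: solution_deriv.
rewrite subr0.
have wb b : `|u - c| < b -> `|v - c| < b -> `|w - c| < b.
  by rewrite !ltr_norml; lra.
have wT : w <= T by lra.
have w0 : 0 <= w by lra.
have xx : `|y - y| < d by rewrite subrr normr0.
apply: le_trans (tube_lipschitz (Hd w y w0 wT (wb _ ud vd) xx) _ _) _.
- by apply: Hd1 => //; exact: wb.
- by apply: Hd1 => //; exact: wb.
rewrite -mulrDr ler_wpM2l//.
have -> : X u w x - X u w x' = z w + (x - x') by rewrite /z subrK.
exact: ler_normD.
Qed.

(* With initial times v, v' on either side of c, the two differences are compared
   from time max(c, v, v') on, along the solution started at (c, y). *)
Lemma flow_almost_linear c t y : 0 <= c -> c <= t -> t <= T ->
  exists2 C, 0 < C & forall e, 0 < e -> exists2 d, 0 < d &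
    forall v v' (a a' b b' : V) k l, 0 <= v -> v <= t -> 0 <= v' -> v' <= t ->
    `|v - c| < d -> `|v' - c| < d ->
    `|a - y| < d -> `|a' - y| < d -> `|b - y| < d -> `|b' - y| < d ->
    k *: (a - a') = l *: (b - b') ->
    `|X v t a - X v t a'| <= C * `|a - a'| /\
    `|k *: (X v t a - X v t a') - l *: (X v' t b - X v' t b')|
      <= e * `|k *: (a - a')|.
Proof.
move=> c0 ct tT.
have cT : c <= T by lra.
have T0 : 0 <= T by lra.
have [K K0 HK] := solution_tube y c0 (lexx c) ct tT.
have [rho1 rho10 Hrho1] := HK 1 ltr01.
have K10 : 0 <= K + 1 by lra.
pose C := expR ((K + 1) * T).
have C1 : 1 <= C by rewrite -expR0 ler_expR mulr_ge0.
have C0 : 0 < C by exact: expR_gt0.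
have expC u w : 0 <= u -> w <= T -> expR ((K + 1) * (w - u)) <= C.
  by move=> u0 wT; rewrite ler_expR ler_wpM2l//; lra.
(* The factor 2 is spent on reaching the common time, where 1 + e2 <= 2, and C on Gronwall after
   it. *)
exists (2 * C); first by rewrite mulr_gt0.
move=> e e0.
pose e1 := e / (8 * C * C * (T + 1)).
have k10 : 0 < 8 * C * C * (T + 1) by rewrite !mulr_gt0//; lra.
have e10 : 0 < e1 by rewrite divr_gt0.
have [rho2 rho20 Hrho2] := HK e1 e10.
pose rho := Num.min rho1 rho2.
have rho0 : 0 < rho by rewrite lt_min rho10.
have C40 : 0 < 4 * C by rewrite mulr_gt0.
(* At the common time both solutions are within rho / (4 * C) of y, hence within rho / (2 * C) of
   each other; the Gronwall factor C then leaves them in the tube of radius rho. *)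
have [d d0 Hd] := flow_stays_near y c0 cT (divr_gt0 rho0 C40).
pose e2 := Num.min 1 (e / (4 * C)).
have e20 : 0 < e2 by rewrite lt_min ltr01 divr_gt0.
have [d' d'0 Hd'] := flow_short_time_diff y c0 cT e20.
exists (Num.min d d'); first by rewrite lt_min d0.
move=> v v' a a' b b' k l v0 vt v'0 v't.
rewrite !lt_min => /andP[vd vd'] /andP[v'd v'd'] /andP[ad ad'].
move=> /andP[a'd a'd'] /andP[bd bd'] /andP[b'd b'd'] kl.
pose m := Num.max c (Num.max v v').
have cm : c <= m by rewrite le_max lexx.
have vm : v <= m by rewrite !le_max lexx orbT.
have v'm : v' <= m by rewrite !le_max lexx !orbT.
have mt : m <= t by rewrite !ge_max ct vt v't.
have m0 : 0 <= m by exact: le_trans cm.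
have mT : m <= T by exact: le_trans tT.
have cc d1 : 0 < d1 -> `|c - c| < d1 by rewrite subrr normr0.
have yy d1 : 0 < d1 -> `|y - y| < d1 by rewrite subrr normr0.
have md d1 : 0 < d1 -> `|v - c| < d1 -> `|v' - c| < d1 -> `|m - c| < d1.
  rewrite /m => d10 h1 h2; case: (leP v v') => _.
    by case: (leP c v') => _ //; exact: cc.
  by case: (leP c v) => _ //; exact: cc.
have close s x : 0 <= s -> s <= m -> `|s - c| < d -> `|x - y| < d ->
    forall r, m <= r -> r <= t -> `|X s r x - X c r y| < rho.
  move=> s0 sm sd xd r mr rt.
  have h1 := Hd s m x s0 sm mT sd (md _ d0 vd v'd) xd.
  have h2 := Hd c m y c0 cm mT (cc _ d0) (md _ d0 vd v'd) (yy _ d0).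
  have h3 : C * `|X s m x - X c m y| < rho.
    have : `|X s m x - X c m y| < rho / (2 * C).
      have -> : X s m x - X c m y = (X s m x - y) - (X c m y - y) by lmod R.
      apply: le_lt_trans (ler_normB _ _) _.
      have -> : rho / (2 * C) = rho / (4 * C) + rho / (4 * C).
        by field; rewrite gt_eqF.
      exact: ltrD.
    rewrite ltr_pdivlMr ?mulr_gt0// => h3; apply: le_lt_trans h3.
    rewrite mulrC ler_wpM2l// mulrC.
    by move: (ltW C0); clear_local; lra.
  apply: le_lt_trans (h3); apply: le_trans (_ : expR ((K + 1) * (r - m)) * _ <= _).
    apply: (solutions_close (t := t) (rho := rho)) => //.
    - move=> w mw wt x1 x2 h4 h5.
      have wc : c <= w by exact: le_trans mw.
      have := tube_lipschitz (Hrho1 w wc wt).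
      by apply; [apply: lt_le_trans h4 _|apply: lt_le_trans h5 _];
        rewrite ge_min lexx.
    - by apply: le_lt_trans h3; rewrite ler_wpM2r// expC.
  by rewrite ler_wpM2r// expC//; move: rt tT; clear_local; lra.
have tube1 r : m <= r -> r <= t -> tube K e1 rho r (X c r y).
  move=> mr rt; have cr : c <= r by exact: le_trans mr.
  by apply: (tubeW _ _ _ (Hrho2 r cr rt)) => //; rewrite ge_min lexx orbT.
have lip r x x' : m <= r -> r <= t -> `|x - X c r y| < rho ->
    `|x' - X c r y| < rho -> `|f r x - f r x'| <= (K + 1) * `|x - x'|.
  move=> mr rt h h'; have cr : c <= r by exact: le_trans mr.
  apply: (tube_lipschitz (Hrho1 r cr rt)).
    by apply: lt_le_trans h _; rewrite ge_min lexx.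
  by apply: lt_le_trans h' _; rewrite ge_min lexx.
have diffC s x x' : 0 <= s -> s <= m -> `|s - c| < d -> `|s - c| < d' ->
    `|x - y| < d -> `|x' - y| < d -> `|x - y| < d' -> `|x' - y| < d' ->
    forall r, m <= r -> r <= t -> `|X s r x - X s r x'| <= 2 * C * `|x - x'|.
  move=> s0 sm sd sd' xd x'd xd' x'd' r mr rt.
  have h := Hd' s m x x' s0 sm mT sd' (md _ d'0 vd' v'd') xd' x'd'.
  have {}h : `|X s m x - X s m x'| <= 2 * `|x - x'|.
    have -> : X s m x - X s m x' =
      (X s m x - X s m x' - (x - x')) + (x - x') by rewrite subrK.
    apply: (le_trans (ler_normD _ _)).
    have : e2 * `|x - x'| <= 1 * `|x - x'|.
      by rewrite ler_wpM2r// ge_min lexx.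
    by move: h; clear_local; lra.
  have := @gronwall_simple m t (K + 1) 0 (fun r => X s r x - X s r x') mt K10 (lexx 0).
  move=> H; have {}H := H _ r mr rt; rewrite mul0r addr0 in H.
  apply: le_trans (H _) _ => [w mw wt|].
    exists (f w (X s w x) - f w (X s w x')).
      by apply: tagged_derivB; exact: solution_deriv.
    by rewrite addr0 lip//; apply: close.
  rewrite [2 * C]mulrC -mulrA; apply: ler_pM => //.
  by rewrite expC//; move: rt tT; clear_local; lra.
split; first by apply: (diffC v) => //; exact: lexx.
set w := `|k *: (a - a')|; have w0 : 0 <= w by exact: normr_ge0.
have wk : `|k| * `|a - a'| = w by rewrite /w normrZ.
have wl : `|l| * `|b - b'| = w by rewrite /w kl normrZ.
(* At the common time m, the relation k (a - a') = l (b - b') cancels the main parts and leaves two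
   short-time errors. After m, the tube bounds the derivative of [z] by K |z| plus a small multiple
   of w. *)
pose z r := k *: (X v r a - X v r a') - l *: (X v' r b - X v' r b').
have zm : `|z m| <= 2 * e2 * w.
  have := Hd' v m a a' v0 vm mT vd' (md _ d'0 vd' v'd') ad' a'd'.
  have := Hd' v' m b b' v'0 v'm mT v'd' (md _ d'0 vd' v'd') bd' b'd'.
  move=> hb ha.
  have -> : z m = k *: (X v m a - X v m a' - (a - a')) -
      l *: (X v' m b - X v' m b' - (b - b')).
    rewrite [in RHS]scalerBr [X in _ - X]scalerBr -kl /z.
    by lmod R.
  apply: (le_trans (ler_normB _ _)); rewrite !normrZ.
  have := ler_wpM2l (normr_ge0 k) ha; have := ler_wpM2l (normr_ge0 l) hb.
  rewrite !(mulrCA _ e2) wk wl; clear_local; lra.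
have g0 : 0 <= e1 * (4 * C * w).
  by rewrite mulr_ge0 ?(ltW e10)// mulr_ge0// ltW.
have := @gronwall_simple m t K (e1 * (4 * C * w)) z mt (ltW K0) g0.
move=> H; have {}H := H _ t mt (lexx t).
apply: le_trans (H _) _ => [r mr rt|].
  exists (k *: (f r (X v r a) - f r (X v r a')) -
          l *: (f r (X v' r b) - f r (X v' r b'))).
    by apply: tagged_derivB; apply: tagged_derivZ; apply: tagged_derivB;
      exact: solution_deriv.
  apply: le_trans (tube1 r mr rt _ _ _ _ _ _ _ _ _ _) _; try exact: close.
  rewrite lerD2l ler_wpM2l ?(ltW e10)// !normrZ.
  have h1 := diffC v a a' v0 vm vd vd' ad a'd ad' a'd' r mr rt.
  have h2 := diffC v' b b' v'0 v'm v'd v'd' bd b'd bd' b'd' r mr rt.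
  have := ler_wpM2l (normr_ge0 k) h1; have := ler_wpM2l (normr_ge0 l) h2.
  rewrite !(mulrCA _ (2 * C)) wk wl; clear_local; lra.
have CK : expR (K * (t - m)) <= C.
  rewrite ler_expR; apply: (@le_trans _ _ (K * T)); last first.
    by rewrite ler_wpM2r// lerDl.
  by rewrite ler_wpM2l ?(ltW K0)//; move: tT m0; clear_local; lra.
have tm0 : 0 <= t - m by rewrite subr_ge0.
apply: le_trans (ler_wpM2r _ CK) _; first by rewrite addr_ge0// mulr_ge0.
apply: almost_linear_budget zm => //; first by rewrite ge_min lexx orbT.
by move: tT m0; clear_local; lra.
Qed.

(** L h is the limit of the quotients (n + 1)(X (y + h / (n + 1)) - X y). By [flow_almost_linear] it
    is approximated by k (X a - X b) whenever k (a - b) = h with a and b near y, so each identity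
    for L reduces to an exact identity between such differences. *)
Lemma flow_strictly_differentiable c t y : 0 <= c -> c <= t -> t <= T ->
  exists2 L : {linear V -> V}, (exists C, forall h, `|L h| <= C * `|h|) &
    forall e, 0 < e -> exists2 d, 0 < d &
    forall v (a b : V), 0 <= v -> v <= t -> `|v - c| < d ->
    `|a - y| < d -> `|b - y| < d ->
    `|X v t a - X v t b - L (a - b)| <= e * `|a - b|.
Proof.
move=> c0 ct tT.
have [C C0 HC] := flow_almost_linear y c0 ct tT.
pose q h n := n.+1%:R *: (X c t (y + n.+1%:R^-1 *: h) - X c t y).
have n0 n : (n.+1%:R : R) != 0 by rewrite pnatr_eq0.
have cc d : 0 < d -> `|c - c| < d by rewrite subrr normr0.
have yy d : 0 < d -> `|y - y| < d by rewrite subrr normr0.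
have scaled h n : n.+1%:R *: (y + n.+1%:R^-1 *: h - y) = h.
  by rewrite addrAC subrr add0r scalerA divff ?scale1r.
have small h d : 0 < d -> \forall n \near \oo, `|y + n.+1%:R^-1 *: h - y| < d.
  move=> d0; have := near_infty_natSinv_lt (PosNum (divr_gt0 d0 (ltr_wpDl (normr_ge0 h) ltr01))).
  apply: filterS => n /=; rewrite ltr_pdivlMr ?ltr_wpDl// => h1.
  rewrite addrAC subrr add0r normrZ ger0_norm ?invr_ge0//.
  by apply: le_lt_trans h1; rewrite ler_wpM2l ?invr_ge0// lerDl.
have q_approx e : 0 < e -> exists2 d, 0 < d & forall v (a b : V) k h,
    0 <= v -> v <= t -> `|v - c| < d -> `|a - y| < d -> `|b - y| < d ->
    k *: (a - b) = h -> \forall n \near \oo,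
    `|q h n - k *: (X v t a - X v t b)| <= e * `|h|.
  move=> e0; have [d d0 Hd] := HC e e0; exists d => // v a b k h v0 vt vd ad bd kab.
  apply: filterS (small h d d0) => n hn.
  have := Hd c v (y + n.+1%:R^-1 *: h) y a b n.+1%:R k c0 ct v0 vt (cc _ d0) vd
    hn (yy _ d0) ad bd.
  by rewrite scaled => /(_ (esym kab))[].
have q_cvg h : cvgn (q h).
  apply: cvgn_of_cauchy => e e0.
  have h1 : 0 < `|h| + 1 by rewrite ltr_wpDl.
  have [d d0 Hd] := HC (e / (`|h| + 1)) (divr_gt0 e0 h1).
  have [N _ HN] := small h d d0; exists N => n Nn.
  have := Hd c c (y + N.+1%:R^-1 *: h) y (y + n.+1%:R^-1 *: h) y N.+1%:R n.+1%:R
    c0 ct c0 ct (cc _ d0) (cc _ d0) (HN N (leqnn N)) (yy _ d0) (HN n Nn) (yy _ d0).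
  rewrite !scaled => /(_ erefl)[_ qq]; apply: le_lt_trans qq _.
  by rewrite mulrAC ltr_pdivrMr// ltr_pM2l// ltrDl.
pose L h := limn (q h).
have L_approx e : 0 < e -> exists2 d, 0 < d & forall v (a b : V) k h,
    0 <= v -> v <= t -> `|v - c| < d -> `|a - y| < d -> `|b - y| < d ->
    k *: (a - b) = h -> `|L h - k *: (X v t a - X v t b)| <= e * `|h|.
  move=> e0; have [d d0 Hd] := q_approx e e0; exists d => //.
  move=> v a b k h *; apply: (@cvgn_norm_le _ _ (q h)); first exact: q_cvg.
  exact: Hd.
have Lq h d : 0 < d -> exists n, `|y + n.+1%:R^-1 *: h - y| < d.
  by move=> d0; have [N _ HN] := small h d d0; exists N; apply: HN => /=.
have L_scale k h : L (k *: h) = k *: L h.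
  apply/eqP; rewrite -subr_eq0; apply/eqP.
  apply: (@norm_le_eps_eq0 _ _ _ (2 * `|k *: h|)) => e e0.
  have [d d0 Hd] := L_approx e e0; have [n hn] := Lq h d d0.
  set F := X c t (y + n.+1%:R^-1 *: h) - X c t y.
  have h1 := Hd c _ _ n.+1%:R h c0 ct (cc _ d0) hn (yy _ d0) (scaled h n).
  have := Hd c _ _ (k * n.+1%:R) (k *: h) c0 ct (cc _ d0) hn (yy _ d0).
  rewrite -scalerA scaled => /(_ erefl) h2.
  have -> : L (k *: h) - k *: L h = (L (k *: h) - (k * n.+1%:R) *: F) -
     k *: (L h - n.+1%:R *: F) by lmod R.
  apply: (le_trans (ler_normB _ _)).
  rewrite [e * _]mulrCA mulr_natl mulr2n; apply: lerD => //.
  by rewrite !normrZ mulrCA ler_wpM2l.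
have L_add h1 h2 : L (h1 + h2) = L h1 + L h2.
  apply/eqP; rewrite -subr_eq0; apply/eqP.
  apply: (@norm_le_eps_eq0 _ _ _ (`|h1 + h2| + `|h1| + `|h2|)) => e e0.
  have [d d0 Hd] := L_approx e e0.
  have : \forall n \near \oo, `|y + n.+1%:R^-1 *: (h1 + h2) - y| < d /\
      `|y + n.+1%:R^-1 *: h1 - y| < d.
    by apply: filterS2 (small (h1 + h2) d d0) (small h1 d d0).
  move=> [N _ /(_ N (leqnn N))[hn1 hn2]].
  (* The way from y to a passes through b. Its second leg does not start at y, which is why
     [L_approx] admits arbitrary end points. *)
  set a := y + _ in hn1; set b := y + _ in hn2.
  have e1 := Hd c _ _ _ _ c0 ct (cc _ d0) hn1 (yy _ d0) (scaled (h1 + h2) N).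
  have e2 := Hd c _ _ _ _ c0 ct (cc _ d0) hn2 (yy _ d0) (scaled h1 N).
  have e3 : `|L h2 - N.+1%:R *: (X c t a - X c t b)| <= e * `|h2|.
    apply: Hd => //; first exact: cc.
    have -> : a - b = N.+1%:R^-1 *: h2 by rewrite /a /b; lmod R.
    by rewrite scalerA divff ?scale1r.
  rewrite -/a in e1; rewrite -/b in e2.
  have -> : L (h1 + h2) - (L h1 + L h2) =
    (L (h1 + h2) - N.+1%:R *: (X c t a - X c t y)) -
    (L h1 - N.+1%:R *: (X c t b - X c t y)) -
    (L h2 - N.+1%:R *: (X c t a - X c t b)) by lmod R.
  rewrite !mulrDr; apply: (le_trans (ler_normB _ _)); apply: lerD => //.
  by apply: (le_trans (ler_normB _ _)); exact: lerD.
have L_linear : linear L by move=> k h1 h2; rewrite L_add L_scale.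
pose LL := HB.pack_for {linear V -> V} L
  (GRing.isLinear.Build R V V *:%R L L_linear).
exists LL.
  exists (C + 1) => h; rewrite -[(LL : V -> V)]/L.
  have [d d0 Hd] := L_approx 1 ltr01; have [d' d'0 Hd'] := HC 1 ltr01.
  have dd : 0 < Num.min d d' by rewrite lt_min d0.
  have [n] := Lq h _ dd; rewrite lt_min => /andP[hn hn'].
  have := Hd c _ _ _ _ c0 ct (cc _ d0) hn (yy _ d0) (scaled h n).
  (* Only the Lipschitz half of [flow_almost_linear] is wanted here, so both scalars are 0. *)
  have [+ _] := Hd' c c _ _ _ _ 0 0 c0 ct c0 ct (cc _ d'0) (cc _ d'0) hn' (yy _ d'0)
    (yy _ d'0) (yy _ d'0) (etrans (scale0r _) (esym (scale0r _))).
  set F := X c t _ - X c t _ => hF hL.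
  rewrite -[L h](subrK (n.+1%:R *: F)); apply: (le_trans (ler_normD _ _)).
  rewrite mulrDl addrC; apply: lerD => //.
  rewrite -[in leRHS](scaled h n) !normrZ mulrCA ler_wpM2l//.
move=> e e0; have [d d0 Hd] := L_approx e e0; exists d => // v a b v0 vt vd ad bd.
have := Hd v a b 1 (a - b) v0 vt vd ad bd (scale1r _).
by rewrite scale1r distrC.
Qed.

Lemma flow_differentiable c t y : 0 <= c -> c <= t -> t <= T ->
  differentiable (X c t) y /\
  (forall e, 0 < e -> exists2 d, 0 < d &
    forall v (a b : V), 0 <= v -> v <= t -> `|v - c| < d ->
    `|a - y| < d -> `|b - y| < d ->
    `|X v t a - X v t b - 'd (X c t) y (a - b)| <= e * `|a - b|).
Proof.
move=> c0 ct tT.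
have [L [C LC] HL] := flow_strictly_differentiable y c0 ct tT.
have [|dX dXL] := @differentiable_of_eps _ _ (X c t) y L C LC.
  move=> e e0; have [d d0 Hd] := HL e e0; exists d => // h hd.
  have := Hd c (y + h) y c0 ct; rewrite subrr normr0 => /(_ d0).
  have -> : y + h - y = h by lmod R.
  by rewrite subrr normr0; apply.
by split => //; rewrite dXL.
Qed.

(** The increment of X v t over a small step s h at x is approximated up to e / 2 by its own
    derivative and, by strict differentiability, also by the one at (c, y); homogeneity removes
    s. *)
Lemma flow_derivative_continuous c t y : 0 <= c -> c <= t -> t <= T ->
  forall e, 0 < e -> exists2 d, 0 < d &
    forall v x h, 0 <= v -> v <= t -> `|v - c| < d -> `|x - y| < d ->
    `|'d (X v t) x h - 'd (X c t) y h| <= e * `|h|.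
Proof.
move=> c0 ct tT e e0; have e20 : 0 < e / 2 by rewrite divr_gt0.
have [_ /(_ _ e20)[d d0 Hd]] := flow_differentiable y c0 ct tT.
exists (d / 2); first by rewrite divr_gt0.
move=> v x h v0 vt vc xy.
have [dX _] := flow_differentiable x v0 vt tT.
have [d' d'0 Hd'] := differentiable_eps dX e20.
pose s := Num.min (d / 2) d' / (`|h| + 1).
have h1 : 0 < `|h| + 1 by rewrite ltr_wpDl.
have s0 : 0 < s by rewrite divr_gt0// lt_min d'0 divr_gt0.
have sh : `|s *: h| < Num.min (d / 2) d'.
  rewrite normrZ gtr0_norm// /s mulrAC ltr_pdivrMr//.
  by rewrite ltr_pM2l ?ltrDl// lt_min d'0 divr_gt0.
move: sh; rewrite lt_min => /andP[sd sd'].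
have := Hd' _ sd'.
have xd : `|x - y| < d by apply: lt_trans xy _; rewrite ltr_pdivrMr// ltr_pMr// ltr1n.
have vd : `|v - c| < d by apply: lt_trans vc _; rewrite ltr_pdivrMr// ltr_pMr// ltr1n.
have xsd : `|x + s *: h - y| < d.
  have -> : x + s *: h - y = (x - y) + s *: h by lmod R.
  by apply: le_lt_trans (ler_normD _ _) _; rewrite [d]splitr ltrD.
have := Hd v _ _ v0 vt vd xsd xd.
have -> : x + s *: h - x = s *: h by lmod R.
set F := X v t _ - X v t x => hy hx.
rewrite -(ler_pM2l s0) -{1}(gtr0_norm s0) -normrZ scalerBr -!linearZ/=.
have -> : 'd (X v t) x (s *: h) - 'd (X c t) y (s *: h) =
  (F - 'd (X c t) y (s *: h)) - (F - 'd (X v t) x (s *: h)) by lmod R.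
apply: (le_trans (ler_normB _ _)); apply: le_trans (lerD hy hx) _.
by rewrite -mulrDl -splitr normrZ gtr0_norm// mulrCA.
Qed.

End flow.

(** * Strong measurability *)

Section strong_measurability.
Context (d : measure_display) (T : measurableType d) (R : realType).
Context (V : completeNormedModType R).
Implicit Types (D : set T) (g h : T -> V) (e : R).

Lemma countable_bigcup_measurable (I : countType) (P : set I) (F : I -> set T) :
  (forall i, P i -> measurable (F i)) -> measurable (\bigcup_(i in P) F i).
Proof.
move=> PF; rewrite bigcup_mkcond.
apply: countable_bigcupT_measurable => [|i]; first exact: countableP.
by case: ifPn => // /set_mem; exact: PF.
Qed.

Lemma countable_enum (C : set V) : countable C ->
  exists u : nat -> V, forall c, C c -> exists n, u n = c.
Proof.
move=> /countable_injP[i iinj].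
exists (fun n => xget 0 [set c | C c /\ i c = n]) => c Cc; exists (i c).
case: xgetP => [x _ [Cx ixc]|/(_ c)]; last by case.
by apply: iinj; rewrite ?inE.
Qed.

(** [separable] asks for points of A, while the u n may lie outside. For each pair (n, m), one point
    of A within 1 / (m + 1) of u n is chosen whenever there is one. *)
Lemma separable_of_dense (A : set V) (u : nat -> V) :
  (forall x, A x -> forall e, 0 < e -> exists n, `|x - u n| < e) -> separable A.
Proof.
move=> Au.
pose p (nm : nat * nat) := [set x | A x /\ `|x - u nm.1| < nm.2.+1%:R^-1].
exists [set x | exists2 nm, p nm x & x = xget 0 (p nm)]; split.
- apply: (@sub_countable _ _ _ [set: nat * nat]); last exact: countableP.
  apply: card_le_trans (card_image_le (fun nm => xget 0 (p nm)) _).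
  by apply: subset_card_le => x [nm _ ->]; exists nm.
- by move=> x [nm []].
- move=> x Ax B /nbhs_normP[e /= e0 eB].
  have [m _ /(_ m (leqnn m)) /= me] :=
    near_infty_natSinv_lt (PosNum (divr_gt0 e0 (ltr0n _ 2))).
  have [n xn] := Au x Ax m.+1%:R^-1 (ltac:(by rewrite invr_gt0)).
  have pnm : p (n, m) x by split.
  pose y := xget 0 (p (n, m)).
  have [Ay yn] : p (n, m) y by apply: xgetPex; exists x.
  exists y; split; first by exists (n, m).
  apply: eB; rewrite /=.
  have -> : x - y = (x - u n) - (y - u n) by lmod R.
  apply: le_lt_trans (ler_normB _ _) _; rewrite [e]splitr.
  by rewrite ltrD// (lt_trans _ me).
Qed.

Lemma strongly_measurableP D g : measurable D -> strongly_measurable D g <->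
  (forall U : set V, open U -> measurable (D `&` g @^-1` U)) /\
  exists u : nat -> V, forall x, D x -> forall e, 0 < e ->
    exists n, `|g x - u n| < e.
Proof.
move=> mD; split=> [[mg [C [cC _ gC]]]|[gU [u Du]]].
  split=> [U oU|]; first by apply: mg => //; exact: sub_sigma_algebra.
  have [u uC] := countable_enum cC; exists u => x Dx e e0.
  have /(_ (ball (g x) e) (nbhsx_ballx _ _ e0))[c [Cc]] : closure C (g x).
    by apply: gC; exists x.
  by have [n <-] := uC c Cc; rewrite -ball_normE => gxe; exists n.
split.
  apply: (@measurability _ _ T (g_sigma_algebraType (@open V)) D g (@open V)) => //.
  by move=> _ [U oU <-]; exact: gU.
by apply: (@separable_of_dense _ u) => _ [x Dx <-]; exact: Du.
Qed.

(** Uniform approximation by a countably valued function u (k x), for every e a criterion for strong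
    measurability. Measurability is asked of the index k, so repeated values in u do no harm and no
    Borel set of V occurs. *)
Definition countably_approx D g e := exists (u : nat -> V) (k : T -> nat),
  (forall n, measurable (D `&` k @^-1` [set n])) /\
  forall x, D x -> `|g x - u (k x)| < e.

Lemma strongly_measurable_approx D g e : measurable D -> 0 < e ->
  strongly_measurable D g -> countably_approx D g e.
Proof.
move=> mD e0 /(strongly_measurableP _ mD)[gU [u Du]].
pose B n := D `&` g @^-1` ball (u n) e.
have mB n : measurable (B n) by apply: gU; exact: ball_open.
have BE n x : D x -> B n x <-> `|g x - u n| < e.
  by move=> Dx; rewrite /B/= -ball_normE/= distrC; split=> [[]|].
(* The index of the first ball that contains g x, so that level sets are differences of measurable
   sets. *)
pose k x := xget 0%N [set n | B n x /\ forall m, (m < n)%N -> ~ B m x].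
have kP x : D x -> B (k x) x /\ forall m, (m < k x)%N -> ~ B m x.
  move=> Dx; apply: (@xgetPex _ 0%N [set n | B n x /\ forall m, (m < n)%N -> ~ B m x]).
  have [n gn] := Du x Dx e e0.
  have ex : exists n, `[< B n x >] by exists n; apply/asboolP/BE.
  exists (ex_minn ex); case: ex_minnP => m /asboolP Bm min; split => // j jm Bj.
  by have := min j (asboolT Bj); rewrite leqNgt jm.
exists u, k; split=> [n|x Dx]; last by apply/BE => //; have [] := kP x Dx.
rewrite (_ : _ `&` _ = B n `\` \bigcup_(m in `I_n) B m).
  by apply: measurableD => //; apply: fin_bigcup_measurable.
apply/seteqP; split=> [x [Dx /= <-]|x [Bn Bm]].
  by have [? H] := kP x Dx; split => // -[m /= mk]; exact: H.
have Dx : D x by case: Bn.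
split => //=; have [Bk H] := kP x Dx; have [kn|nk|//] := ltngtP (k x) n.
  by exfalso; apply: Bm; exists (k x).
by have := H n nk.
Qed.

Lemma strongly_measurable_of_approx D g : measurable D ->
  (forall e, 0 < e -> countably_approx D g e) -> strongly_measurable D g.
Proof.
move=> mD H; apply/(strongly_measurableP _ mD).
have {}H m : countably_approx D g m.+1%:R^-1 by apply: H; rewrite invr_gt0.
have [u /choice[k Huk]] := choice H; split.
  move=> U oU.
  (* If U contains the ball of radius e at g x and 1 / (m + 1) < e / 2, then the m-th approximating
     value at x is the centre of a ball inside U. *)
  pose good := [set mn : nat * nat |
    ball (u mn.1 mn.2) mn.1.+1%:R^-1 `<=` U].
  rewrite (_ : _ `&` _ = \bigcup_(mn in good) (D `&` k mn.1 @^-1` [set mn.2])).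
    by apply: countable_bigcup_measurable => mn _; exact: (Huk mn.1).1.
  apply/seteqP; split=> [x [Dx /= Ugx]|x [[m n] /= gmn [Dx /= kx]]]; last first.
    split => //; apply: gmn; rewrite -ball_normE /= distrC -kx.
    exact: (Huk m).2.
  have [e /= e0 eU] : nbhs_ball (g x) U.
    by apply/nbhs_ballP; exact: open_nbhs_nbhs.
  have [m _ /(_ m (leqnn m)) /= me] :=
    near_infty_natSinv_lt (PosNum (divr_gt0 e0 (ltr0n _ 2))).
  exists (m, k m x) => //= y; rewrite -ball_normE /= => uy.
  apply: eU; rewrite -ball_normE /=.
  have -> : g x - y = (g x - u m (k m x)) + (u m (k m x) - y) by lmod R.
  apply: le_lt_trans (ler_normD _ _) _; rewrite [e]splitr.
  by rewrite ltrD// (lt_trans _ me)//; exact: (Huk m).2.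
exists (fun n => if unpickle n is Some (i, j) then u i j else 0).
move=> x Dx e e0.
have [m _ /(_ m (leqnn m)) /= me] := near_infty_natSinv_lt (PosNum e0).
exists (pickle (m, k m x)); rewrite pickleK (lt_trans _ me)//.
exact: (Huk m).2.
Qed.

(** Two approximations combine by coding their indices as one number. This avoids the Borel sets of
    V x V, which products of Borel sets need not generate when V is not separable. *)
Lemma strongly_measurable_lipschitz2 D g h (F : V -> V -> V) (C : R) :
  measurable D ->
  (forall a b a' b', `|F a b - F a' b'| <= C * (`|a - a'| + `|b - b'|)) ->
  strongly_measurable D g -> strongly_measurable D h ->
  strongly_measurable D (fun x => F (g x) (h x)).
Proof.
move=> mD FC mg mh; apply: strongly_measurable_of_approx => // e e0.
have C0 : 0 < `|C| + 1 by rewrite ltr_wpDl.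
have e1 : 0 < e / (2 * (`|C| + 1)) by rewrite divr_gt0// mulr_gt0.
have [u [k [mk uk]]] := strongly_measurable_approx mD e1 mg.
have [w [l [ml wl]]] := strongly_measurable_approx mD e1 mh.
exists (fun n => if unpickle n is Some (i, j) then F (u i) (w j) else 0).
exists (fun x => pickle (k x, l x)); split=> [n|x Dx].
  rewrite (_ : _ `&` _ = \bigcup_(ij in [set ij : nat * nat | pickle ij = n])
      ((D `&` k @^-1` [set ij.1]) `&` (D `&` l @^-1` [set ij.2]))).
    by apply: countable_bigcup_measurable => ij _; exact: measurableI.
  apply/seteqP; split=> [x [Dx /= <-]|x [[i j] /= ijn [[Dx /= ki] [_ /= lj]]]].
    by exists (k x, l x).
  by split => //=; rewrite ki lj.
rewrite pickleK; apply: le_lt_trans (FC _ _ _ _) _.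
have := ltrD (uk x Dx) (wl x Dx).
have -> : e / (2 * (`|C| + 1)) + e / (2 * (`|C| + 1)) = e / (`|C| + 1).
  by field; rewrite gt_eqF.
rewrite ltr_pdivlMr//; apply: le_lt_trans.
by rewrite mulrC ler_wpM2l ?addr_ge0// (le_trans (ler_norm C))// lerDl.
Qed.

Lemma strongly_measurable_subset D D' g : measurable D -> measurable D' ->
  D' `<=` D -> strongly_measurable D g -> strongly_measurable D' g.
Proof.
move=> mD mD' DD /(strongly_measurableP _ mD)[gU [u Du]].
apply/(strongly_measurableP _ mD'); split; last by exists u => x /DD; exact: Du.
move=> U oU; rewrite (_ : _ `&` _ = D' `&` (D `&` g @^-1` U)).
  by apply: measurableI => //; exact: gU.
by rewrite setIA; congr (_ `&` _); rewrite setIidl.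
Qed.

Lemma strongly_measurable_cst D (v : V) : measurable D ->
  strongly_measurable D (fun=> v).
Proof.
move=> mD; apply/(strongly_measurableP _ mD); split.
  by move=> U oU; rewrite preimage_cst; case: ifP => _; rewrite ?setIT ?setI0.
by exists (fun=> v) => x _ e e0; exists 0%N; rewrite subrr normr0.
Qed.

Lemma strongly_measurable_lim D g (s : nat -> T -> V) : measurable D ->
  (forall n, strongly_measurable D (s n)) ->
  (forall x, D x -> s n x @[n --> \oo] --> g x) -> strongly_measurable D g.
Proof.
move=> mD ms sg.
have {}ms n := (strongly_measurableP (s n) mD).1 (ms n).
apply/(strongly_measurableP _ mD); split.
  move=> U oU.
  (* K m is closed, and g x lies in U iff for some m the sequence s n x is
     eventually in K m *)
  pose K m := [set y | ball y m.+1%:R^-1 `<=` U].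
  have mK m : open (~` K m).
    rewrite openE => y /= /existsNP[z /not_implyP[yz Uz]].
    move: yz; rewrite -ball_normE /= => yz.
    apply/nbhs_normP; exists (m.+1%:R^-1 - `|y - z|); first by rewrite /= subr_gt0.
    move=> y' /= yy' Ky'; apply: Uz; apply: Ky'; rewrite -ball_normE /=.
    have -> : y' - z = (y - z) - (y - y') by lmod R.
    by apply: le_lt_trans (ler_normB _ _) _; rewrite addrC -ltrBrDr.
  rewrite (_ : _ `&` _ = \bigcup_m \bigcup_N \bigcap_(n in [set n | (N <= n)%N])
      (D `&` s n @^-1` K m)).
    apply: bigcupT_measurable => m; apply: bigcupT_measurable => N.
    apply: bigcap_measurable; first by exists N => /=.
    move=> n _; rewrite (_ : _ `&` _ = D `\` (D `&` s n @^-1` (~` K m))).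
      by apply: measurableD => //; exact: (ms n).1.
    rewrite setDE setCI setIUr setICr set0U preimage_setC.
    by congr (_ `&` _); rewrite setCK.
  apply/seteqP; split=> [x [Dx /= Ugx]|x [m _ [N _ H]]].
    have [e /= e0 eU] : nbhs_ball (g x) U.
      by apply/nbhs_ballP; exact: open_nbhs_nbhs.
    have [m _ /(_ m (leqnn m)) /= me] :=
      near_infty_natSinv_lt (PosNum (divr_gt0 e0 (ltr0n _ 2))).
    have /cvgrPdist_lt/(_ _ (divr_gt0 e0 (ltr0n _ 2)))[N _ HN] := sg x Dx.
    exists m => //; exists N => // n /= Nn; split => //= y.
    rewrite -ball_normE /= => sy; apply: eU; rewrite -ball_normE /=.
    have -> : g x - y = (g x - s n x) + (s n x - y) by lmod R.
    apply: le_lt_trans (ler_normD _ _) _; rewrite [e]splitr.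
    by apply: ltrD; [exact: HN|exact: lt_trans me].
  have Dx : D x by have [] := H N (leqnn N).
  split => //=.
  have /cvgrPdist_lt/(_ m.+1%:R^-1 (ltac:(by rewrite invr_gt0)))[N' _ HN'] := sg x Dx.
  have [_ /=] := H (maxn N N') (leq_maxl _ _); apply.
  by rewrite -ball_normE /= distrC; apply: HN'; exact: leq_maxr.
have [u us] := choice (fun n => (ms n).2).
exists (fun n => if unpickle n is Some (i, j) then u i j else 0).
move=> x Dx e e0; have e20 : 0 < e / 2 by rewrite divr_gt0.
have /cvgrPdist_lt/(_ _ e20)[N _ /(_ N (leqnn N)) /= gN] := sg x Dx.
have [n sn] := us N x Dx _ e20.
exists (pickle (N, n)); rewrite pickleK.
have -> : g x - u N n = (g x - s N x) + (s N x - u N n) by lmod R.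
by apply: le_lt_trans (ler_normD _ _) _; rewrite [e]splitr ltrD.
Qed.

Lemma strongly_measurable_glue D (s : nat -> T -> V) (k : T -> nat) :
  measurable D -> (forall n, measurable (D `&` k @^-1` [set n])) ->
  (forall n, strongly_measurable D (s n)) ->
  strongly_measurable D (fun x => s (k x) x).
Proof.
move=> mD mk ms.
have {}ms n := (strongly_measurableP (s n) mD).1 (ms n).
apply/(strongly_measurableP _ mD); split.
  move=> U oU; rewrite (_ : _ `&` _ = \bigcup_n
      ((D `&` k @^-1` [set n]) `&` (D `&` s n @^-1` U))).
    apply: bigcupT_measurable => n; apply: measurableI => //.
    exact: (ms n).1.
  apply/seteqP; split=> [x [Dx /= Ux]|x [n _ [[Dx /= <-] [_ /= ?]]]] //.
  by exists (k x).
have [u us] := choice (fun n => (ms n).2).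
exists (fun n => if unpickle n is Some (i, j) then u i j else 0).
move=> x Dx e e0; have [n sn] := us (k x) x Dx e e0.
by exists (pickle (k x, n)); rewrite pickleK.
Qed.

(** With a countably valued function in place of g, the composition is glued from the functions F x
    v with v fixed; continuity in the second argument passes to the limit. *)
Lemma strongly_measurable_caratheodory D (F : T -> V -> V) g : measurable D ->
  (forall v, strongly_measurable D (F^~ v)) ->
  (forall x, D x -> forall y (e : R), 0 < e -> exists2 r, 0 < r &
     forall y', `|y' - y| < r -> `|F x y' - F x y| < e) ->
  strongly_measurable D g -> strongly_measurable D (fun x => F x (g x)).
Proof.
move=> mD mF cF mg.
have H n : countably_approx D g n.+1%:R^-1.
  by apply: strongly_measurable_approx => //; rewrite invr_gt0.
have [u /choice[k Huk]] := choice H.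
apply: (@strongly_measurable_lim _ _ (fun n x => F x (u n (k n x)))) => //.
  by move=> n; apply: (strongly_measurable_glue mD (Huk n).1 (s := fun j x => F x (u n j))).
move=> x Dx; apply/cvgrPdist_lt => e e0.
have [r r0 Hr] := cF x Dx (g x) e e0.
apply: filterS (near_infty_natSinv_lt (PosNum r0)) => n /= nr.
rewrite distrC; apply: Hr; rewrite distrC (lt_trans _ nr)//; exact: (Huk n).2.
Qed.

End strong_measurability.

(** * Bochner integrals *)

Section simple_functions.
Context (d : measure_display) (T : measurableType d).

(** Values lie in any type, so that a pair of simple functions is again simple. On a set of finite
    measure, the finiteness clause of [simple_integrable] is automatic. *)
Definition simple_on (I : Type) (D : set T) (s : T -> I) :=
  finite_set (s @` D) /\ forall i, measurable (D `&` s @^-1` [set i]).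

Lemma simple_on_subset (I : Type) (D E : set T) (s : T -> I) :
  measurable E -> E `<=` D -> simple_on D s -> simple_on E s.
Proof.
move=> mE ED [fs ms]; split.
  by apply: sub_finite_set fs; exact: image_subset.
move=> i; rewrite (_ : _ `&` _ = E `&` (D `&` s @^-1` [set i])).
  exact: measurableI.
by rewrite setIA; congr (_ `&` _); rewrite setIidl.
Qed.

Lemma simple_on_preimage (I : choiceType) (D : set T) (s : T -> I) (Y : set I) :
  simple_on D s -> measurable (D `&` s @^-1` Y).
Proof.
move=> [fs ms]; rewrite (_ : _ `&` _ =
    \bigcup_(i in s @` D `&` Y) (D `&` s @^-1` [set i])).
  by apply: fin_bigcup_measurable => // ; exact: finite_setIl.
apply/seteqP; split=> [x [Dx Yx]|x [i [_ Yi] [Dx /= si]]].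
  by exists (s x) => //; split => //; exists x.
by split => //=; rewrite si.
Qed.

Lemma simple_on_pair (I J : choiceType) (D : set T) (s : T -> I) (u : T -> J) :
  simple_on D s -> simple_on D u -> simple_on D (fun x => (s x, u x)).
Proof.
move=> [fs ms] [fu mu]; split.
  apply: (@sub_finite_set _ _ (s @` D `*` u @` D)); last exact: finite_setX.
  by move=> _ [x Dx <-]; split; exists x.
move=> [i j]; rewrite (_ : _ `&` _ =
    (D `&` s @^-1` [set i]) `&` (D `&` u @^-1` [set j])).
  exact: measurableI.
by apply/seteqP; split=> [x [Dx [<- <-]]|x [[Dx /= <-] [_ /= <-]]].
Qed.

Lemma simple_on_comp (I J : choiceType) (D : set T) (s : T -> I) (phi : I -> J) :
  simple_on D s -> simple_on D (fun x => phi (s x)).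
Proof.
move=> ss; split.
  rewrite (_ : _ @` D = phi @` (s @` D)); last by rewrite image_comp.
  by apply: finite_image; exact: ss.1.
by move=> j; apply: (simple_on_preimage (phi @^-1` [set j]) ss).
Qed.

(** Reduces claims on simple integrals to constant functions. The induction is on a list that
    contains the values taken on E, one fibre being split off at a time. *)
Lemma simple_on_ind (I : choiceType) (D : set T) (s : T -> I)
    (P : set T -> Prop) : measurable D -> simple_on D s -> P set0 ->
  (forall E i, measurable E -> E `<=` D -> (forall x, E x -> s x = i) -> P E) ->
  (forall E F, measurable E -> measurable F -> E `<=` D -> F `<=` D ->
    [disjoint E & F] -> P E -> P F -> P (E `|` F)) ->
  P D.
Proof.
move=> mD ss P0 Pc PU.
have /finite_seqP[r rE] := ss.1.
suff H : forall (r : seq I) (E : set T), measurable E -> E `<=` D -> (forall x, E x -> s x \in r) -> P E.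
  apply: (H r) => // x Dx; have : (s @` D) (s x) by exists x.
  by rewrite rE.
elim=> [|i {rE}r' IH] E mE ED Er.
  by rewrite (_ : E = set0)//; apply/seteqP; split=> // x /Er.
have mEi := (simple_on_subset mE ED ss).2 i.
rewrite -(setUIDK E (s @^-1` [set i])); apply: PU => //.
- rewrite (_ : _ `\` _ = E `\` (E `&` s @^-1` [set i])); first exact: measurableD.
  by rewrite setDIr setDv set0U.
- by move=> x [/ED].
- by move=> x [/ED].
- by apply/disj_set2P; rewrite setDE setIACA setICr setI0.
- by apply: (Pc _ i) => // x []; move=> /ED.
apply: IH.
- rewrite (_ : _ `\` _ = E `\` (E `&` s @^-1` [set i])); first exact: measurableD.
  by rewrite setDIr setDv set0U.
- by move=> x [/ED].
- by move=> x [/Er + /= /eqP/negbTE si]; rewrite inE si.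
Qed.

End simple_functions.

Section bochner_theory.
Context (d : measure_display) (T : measurableType d) (R : realType).
Context (mu : {measure set T -> \bar R}) (V : completeNormedModType R).
Implicit Types (D E F : set T) (g h s u : T -> V) (v w : V) (e : R).

Lemma simple_on_strongly_measurable D s : measurable D -> simple_on D s ->
  strongly_measurable D s.
Proof.
move=> mD ss; apply/(strongly_measurableP _ mD); split.
  by move=> U _; exact: simple_on_preimage.
have /finite_seqP[r rE] := ss.1.
exists (fun n => nth 0 r n) => x Dx e e0.
exists (index (s x) r); rewrite nth_index ?subrr ?normr0//.
have : (s @` D) (s x) by exists x.
by rewrite rE.
Qed.

Lemma strongly_measurable_norm D g : measurable D -> strongly_measurable D g ->
  measurable_fun D (fun x => `|g x|).
Proof.
move=> mD /(strongly_measurableP _ mD)[gU _] _.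
apply: (measurability _ (RGenInftyO.measurableE R)) => //.
move=> _ [_ [a ->] <-].
rewrite (_ : _ `&` _ = D `&` g @^-1` [set y | `|y| < a]).
  apply: gU; rewrite (_ : mkset _ = (@Num.norm R V) @^-1` `]-oo, a[%classic).
    by apply: open_comp => // x _; exact: norm_continuous.
  by apply/seteqP; split=> x /=; rewrite in_itv.
by apply/seteqP; split=> x /=; rewrite in_itv.
Qed.

Lemma strongly_measurableB D g h : measurable D -> strongly_measurable D g ->
  strongly_measurable D h -> strongly_measurable D (fun x => g x - h x).
Proof.
move=> mD; apply: (strongly_measurable_lipschitz2 (C := 1) (F := fun a b => a - b)) => //.
move=> a b a' b'; have -> : a - b - (a' - b') = (a - a') - (b - b') by lmod R.
by rewrite mul1r ler_normB.
Qed.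

Lemma strongly_measurableD D g h : measurable D -> strongly_measurable D g ->
  strongly_measurable D h -> strongly_measurable D (fun x => g x + h x).
Proof.
move=> mD; apply: (strongly_measurable_lipschitz2 (C := 1) (F := fun a b => a + b)) => //.
move=> a b a' b'; have -> : a + b - (a' + b') = (a - a') + (b - b') by lmod R.
by rewrite mul1r ler_normD.
Qed.

Lemma strongly_measurable_linear D g (L : {linear V -> V}) (C : R) :
  measurable D -> (forall x, `|L x| <= C * `|x|) -> strongly_measurable D g ->
  strongly_measurable D (fun x => L (g x)).
Proof.
move=> mD LC mg.
apply: (strongly_measurable_lipschitz2 (C := `|C|) (F := fun a _ => L a) mD _ mg mg).
move=> a b a' b'; rewrite -linearB; apply: le_trans (LC _) _.
apply: (@le_trans _ _ (`|C| * `|a - a'|)); first by rewrite ler_wpM2r// ler_norm.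
by rewrite ler_wpM2l// lerDl.
Qed.

Lemma integral_norm_le2 D g h u : measurable D -> strongly_measurable D g ->
  strongly_measurable D h -> strongly_measurable D u ->
  (forall x, D x -> `|g x| <= `|h x| + `|u x|) ->
  (\int[mu]_(x in D) (`|g x|)%:E <=
   \int[mu]_(x in D) (`|h x|)%:E + \int[mu]_(x in D) (`|u x|)%:E)%E.
Proof.
move=> mD mg mh mu' ghu.
have mE (f : T -> V) : strongly_measurable D f -> measurable_fun D (fun x => (`|f x|)%:E).
  by move=> mf; apply/measurable_EFinP; exact: strongly_measurable_norm.
rewrite -ge0_integralD//; last 2 first.
- exact: mE.
- exact: mE.
apply: ge0_le_integral => //; first exact: mE.
  by apply: emeasurable_funD; exact: mE.
Qed.

Lemma simple_integralE D s (F' : set V) : finite_set F' -> s @` D `<=` F' ->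
  simple_integral mu D s =
  \sum_(v \in F') fine (mu (D `&` s @^-1` [set v])) *: v.
Proof.
move=> fF sF; apply: fsbig_widen => // v [Fv /= nv].
rewrite (_ : _ `&` _ = set0) ?measure0 ?scale0r//.
by apply/seteqP; split=> // x [Dx sx]; apply: nv; exists x.
Qed.

Lemma simple_integral_cst E s v : (forall x, E x -> s x = v) ->
  simple_integral mu E s = fine (mu E) *: v.
Proof.
move=> sv; rewrite (@simple_integralE E s [set v])//.
  rewrite fsbig_set1 (_ : _ `&` _ = E)//.
  by apply/seteqP; split=> [x []//|x Ex]; split => //; exact: sv.
by move=> _ [x Ex <-]; exact: sv.
Qed.

Lemma finite_measure_subset D E : measurable D -> measurable E ->
  (mu D < +oo)%E -> E `<=` D -> mu E \is a fin_num.
Proof.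
move=> mD mE fD ED; rewrite ge0_fin_numE//.
by apply: le_lt_trans fD; apply: le_measure; rewrite ?inE.
Qed.

Lemma simple_integral_setU D E F s : measurable D -> (mu D < +oo)%E ->
  simple_on D s -> measurable E -> measurable F -> E `<=` D -> F `<=` D ->
  [disjoint E & F] ->
  simple_integral mu (E `|` F) s = simple_integral mu E s + simple_integral mu F s.
Proof.
move=> mD fD ss mE mF ED FD EF.
have sE := simple_on_subset mE ED ss; have sF := simple_on_subset mF FD ss.
have sub A : A `<=` D -> s @` A `<=` s @` D by exact: image_subset.
rewrite (simple_integralE ss.1); last by apply: sub => x [/ED|/FD].
rewrite (simple_integralE ss.1 (sub _ ED)) (simple_integralE ss.1 (sub _ FD)).
rewrite -fsbig_split; last exact: ss.1.
(* [fine] is additive only on finite values; here the finite measure of D enters. *)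
apply: eq_fsbigr => v _; rewrite -[RHS]scalerDl -fineD; last 2 first.
- by apply: (finite_measure_subset mD (sE.2 v) fD) => x [/ED].
- by apply: (finite_measure_subset mD (sF.2 v) fD) => x [/FD].
congr (fine _ *: _); rewrite setIUl measureU//; first exact: sE.2.
  exact: sF.2.
rewrite -subset0 => x [[Ex _] [Fx _]].
by move/disj_set2P: EF => <-.
Qed.

Section finite_domain.
Context (D : set T) (mD : measurable D) (fD : (mu D < +oo)%E).

Lemma simple_integralB s u : simple_on D s -> simple_on D u ->
  simple_integral mu D (fun x => s x - u x) =
  simple_integral mu D s - simple_integral mu D u.
Proof.
move=> ss su; have sp := simple_on_pair ss su.
have sB : simple_on D (fun x => s x - u x).
  by apply: (simple_on_comp (fun p => p.1 - p.2) sp).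
(* The induction runs over the fibres of the pair (s, u), on which both functions are constant. *)
apply: (simple_on_ind (P := fun E => simple_integral mu E (fun x => s x - u x) =
  simple_integral mu E s - simple_integral mu E u) mD sp).
- by rewrite !(@simple_integral_cst set0 _ 0)// scaler0 subr0.
- move=> E [v w] mE ED vw.
  rewrite (@simple_integral_cst E s v); last by move=> x /vw[].
  rewrite (@simple_integral_cst E u w); last by move=> x /vw[].
  rewrite (@simple_integral_cst E _ (v - w)) ?scalerBr// => x /vw[-> ->] //.
- move=> E F mE mF ED FD EF.
  rewrite !(simple_integral_setU mD fD _ mE mF)// => -> ->.
  by lmod R.
Qed.

Lemma simple_integral_linear s (L : {linear V -> V}) : simple_on D s ->
  simple_integral mu D (fun x => L (s x)) = L (simple_integral mu D s).
Proof.
move=> ss; have sL := simple_on_comp L ss.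
apply: (simple_on_ind (P := fun E => simple_integral mu E (fun x => L (s x)) =
  L (simple_integral mu E s)) mD ss).
- by rewrite !(@simple_integral_cst set0 _ 0)// !scaler0 linear0.
- move=> E v mE ED sv.
  rewrite (@simple_integral_cst E s v)// (@simple_integral_cst E _ (L v)).
    by rewrite linearZ.
  by move=> x /sv ->.
- move=> E F mE mF ED FD EF.
  by rewrite !(simple_integral_setU mD fD _ mE mF)// linearD => -> ->.
Qed.

Lemma simple_integral_norm s : simple_on D s ->
  ((`|simple_integral mu D s|)%:E <= \int[mu]_(x in D) (`|s x|)%:E)%E.
Proof.
move=> ss.
apply: (simple_on_ind (P := fun E =>
  ((`|simple_integral mu E s|)%:E <= \int[mu]_(x in E) (`|s x|)%:E)%E) mD ss).
- by rewrite (@simple_integral_cst set0 _ 0)// scaler0 normr0 integral_ge0.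
- move=> E v mE ED sv; rewrite (@simple_integral_cst E s v)//.
  rewrite (eq_integral (cst (`|v|)%:E)); last first.
    by move=> x; rewrite inE => /sv ->.
  rewrite integral_cst// normrZ ger0_norm ?fine_ge0// mulrC EFinM fineK//.
  exact: finite_measure_subset fD ED.
- move=> E F mE mF ED FD EF hE hF.
  rewrite (simple_integral_setU mD fD ss mE mF)// ge0_integral_setU//; last first.
    apply/measurable_EFinP; apply: strongly_measurable_norm.
      exact: measurableU.
    apply: simple_on_strongly_measurable; first exact: measurableU.
    by apply: simple_on_subset ss; [exact: measurableU|move=> x [/ED|/FD]].
  by apply: le_trans (leeD hE hF); rewrite -EFinD lee_fin ler_normD.
Qed.

(** The Bochner integral on a domain of finite measure, with the approximating sequence replaced by
    one simple function for each e. *)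
Definition bint g v := strongly_measurable D g /\ forall e, 0 < e ->
  exists s, [/\ simple_on D s, (\int[mu]_(x in D) (`|g x - s x|)%:E <= e%:E)%E &
    `|simple_integral mu D s - v| <= e].

Lemma simple_integrableP s : simple_integrable mu D s <-> simple_on D s.
Proof.
split=> [[fs ms _]//|ss]; split => [||v _]; first exact: ss.1; first exact: ss.2.
rewrite -ge0_fin_numE//; apply: finite_measure_subset fD _ => //.
exact: ss.2.
Qed.

Lemma bintP g v : is_bochner_integral mu D g v <-> bint g v.
Proof.
split=> [[mg [s [ss sg sv]]]|[mg H]]; split => //.
  move=> e e0.
  have /fine_cvgP[fin /cvgrPdist_le/(_ e e0) cv] := sg.
  have /cvgrPdist_le/(_ e e0) cv' := sv.
  near \oo => n; exists (s n); split.
  - by apply/simple_integrableP.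
  - have fn : (\int[mu]_(x in D) (`|g x - s n x|)%:E)%E \is a fin_num by near: n.
    rewrite -(fineK fn) lee_fin.
    have := ler_norm (- (0 - fine (\int[mu]_(x in D) (`|g x - s n x|)%:E)%E)).
    rewrite sub0r opprK => /le_trans; apply; rewrite -normrN -sub0r.
    by near: n.
  - by rewrite distrC; near: n.
have {}H n : exists s, [/\ simple_on D s,
    (\int[mu]_(x in D) (`|g x - s x|)%:E <= (n.+1%:R^-1)%:E)%E &
    `|simple_integral mu D s - v| <= n.+1%:R^-1].
  by apply: H; rewrite invr_gt0.
have [s sP] := choice H; exists s; split.
- by move=> n; apply/simple_integrableP; have [] := sP n.
- have s0 n : (0 <= \int[mu]_(x in D) (`|g x - s n x|)%:E)%E by exact: integral_ge0.
  apply: (@squeeze_cvge _ _ _ _ (fun=> 0%E) _ (fun n => (n.+1%:R^-1 : R)%:E)).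
  + by apply: nearW => n; rewrite s0 /=; have [] := sP n.
  + exact: cvg_cst.
  + by apply/fine_cvgP; split; [exact: nearW|exact: cvg_harmonic].
- apply/cvgrPdist_le => e e0.
  apply: filterS (near_infty_natSinv_lt (PosNum e0)) => n /= ne.
  by rewrite distrC; apply: le_trans (ltW ne); have [] := sP n.
Unshelve. all: by end_near. Qed.

Lemma bint_simple s : simple_on D s -> bint s (simple_integral mu D s).
Proof.
move=> ss; split; first exact: simple_on_strongly_measurable.
move=> e e0; exists s; split => //; last by rewrite subrr normr0 ltW.
rewrite integral0_eq ?lee_fin ?ltW// => x _.
by rewrite subrr normr0.
Qed.

Lemma bint_norm g v : bint g v ->
  ((`|v|)%:E <= \int[mu]_(x in D) (`|g x|)%:E)%E.
Proof.
move=> [mg H]; apply/lee_addgt0Pr => e e0.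
have [s [ss gs sv]] := H _ (divr_gt0 e0 (ltr0n _ 2)).
have ms := simple_on_strongly_measurable mD ss.
have mgs := strongly_measurableB mD mg ms.
apply: (@le_trans _ _ ((`|simple_integral mu D s|)%:E + (e / 2)%:E)%E).
  rewrite -EFinD lee_fin.
  have {1}-> : v = simple_integral mu D s - (simple_integral mu D s - v) by lmod R.
  by apply: le_trans (ler_normB _ _) _; rewrite lerD.
apply: (@le_trans _ _ (\int[mu]_(x in D) (`|g x|)%:E + (e / 2)%:E + (e / 2)%:E)%E).
  apply: leeD => //; apply: le_trans (simple_integral_norm ss) _.
  apply: le_trans (integral_norm_le2 mD ms mg mgs _) (leeD _ gs) => //.
  move=> x _; have {1}-> : s x = g x - (g x - s x) by lmod R.
  exact: ler_normB.
by rewrite -addeA -EFinD -splitr.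
Qed.

Lemma bintB g h v w : bint g v -> bint h w -> bint (fun x => g x - h x) (v - w).
Proof.
move=> [mg Hg] [mh Hh]; split; first exact: strongly_measurableB.
move=> e e0; have e20 := divr_gt0 e0 (ltr0n R 2).
have [s [ss gs sv]] := Hg _ e20; have [u [su hu uw]] := Hh _ e20.
have ms := simple_on_strongly_measurable mD ss.
have mu' := simple_on_strongly_measurable mD su.
have ssu : simple_on D (fun x => s x - u x).
  by apply: (simple_on_comp (fun p => p.1 - p.2) (simple_on_pair ss su)).
exists (fun x => s x - u x); split => //.
  apply: (@le_trans _ _ ((e / 2)%:E + (e / 2)%:E)%E); last by rewrite -EFinD -splitr.
  apply: le_trans (integral_norm_le2 mD _ (strongly_measurableB mD mg ms)
    (strongly_measurableB mD mh mu') _) (leeD gs hu).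
    apply: strongly_measurableB => //; first exact: strongly_measurableB.
    exact: strongly_measurableB.
  move=> x _; have -> : g x - h x - (s x - u x) = (g x - s x) - (h x - u x) by lmod R.
  exact: ler_normB.
rewrite simple_integralB//.
have -> : simple_integral mu D s - simple_integral mu D u - (v - w) =
  (simple_integral mu D s - v) - (simple_integral mu D u - w) by lmod R.
by apply: le_trans (ler_normB _ _) _; rewrite [e]splitr lerD.
Qed.

Lemma bint_linear g v (L : {linear V -> V}) (C : R) :
  (forall x, `|L x| <= C * `|x|) -> bint g v -> bint (fun x => L (g x)) (L v).
Proof.
move=> LC [mg Hg]; have C0 : 0 < `|C| + 1 by rewrite ltr_wpDl.
have {}LC x : `|L x| <= (`|C| + 1) * `|x|.
  by apply: le_trans (LC x) _; rewrite ler_wpM2r// ler_wpDr// ler_norm.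
split; first exact: strongly_measurable_linear LC mg.
move=> e e0; have [s [ss gs sv]] := Hg _ (divr_gt0 e0 C0).
have ms := simple_on_strongly_measurable mD ss.
exists (fun x => L (s x)); split; first exact: simple_on_comp.
  apply: (@le_trans _ _ ((`|C| + 1)%:E * \int[mu]_(x in D) (`|g x - s x|)%:E)%E).
    have mgs := strongly_measurableB mD mg ms.
    have mN : measurable_fun D (fun x => (`|g x - s x|)%:E).
      by apply/measurable_EFinP; exact: strongly_measurable_norm.
    rewrite -ge0_integralZl_EFin ?(ltW C0)//.
    apply: ge0_le_integral => //.
    - apply/measurable_EFinP; apply: strongly_measurable_norm => //.
      by apply: strongly_measurableB => //; apply: strongly_measurable_linear LC _.
    - exact: measurable_funeM.
    - by move=> x _; rewrite -EFinM lee_fin -linearB.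
  apply: le_trans (lee_wpmul2l _ gs) _; first by rewrite lee_fin ltW.
  by rewrite -EFinM lee_fin mulrC divfK// gt_eqF.
rewrite simple_integral_linear// -linearB; apply: le_trans (LC _) _.
by rewrite mulrC -ler_pdivlMr.
Qed.

(** The difference of two values is an integral of g - g = 0, and [bint_norm] bounds it by 0. *)
Lemma bint_unique g v w : bint g v -> bint g w -> v = w.
Proof.
move=> gv gw; have := bint_norm (bintB gv gw).
rewrite integral0_eq; last by move=> x _; rewrite subrr normr0.
by rewrite lee_fin normr_le0 subr_eq0 => /eqP.
Qed.

Lemma bint_bochner g v : bint g v -> bochner_integral mu D g = v.
Proof.
move=> gv; apply: (@bint_unique g) => //; apply/bintP.
by apply: (@xgetPex _ 0 (is_bochner_integral mu D g)); exists v; apply/bintP.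
Qed.

(** A countably valued approximation within c is cut off at index N. The uniform error costs at most
    c * mu D <= e / 2; where k x >= N the error is |g| itself, and dominated convergence makes this
    tail small. *)
Lemma simple_approx g e : strongly_measurable D g -> 0 < e ->
  (\int[mu]_(x in D) (`|g x|)%:E < +oo)%E ->
  exists2 s, simple_on D s & (\int[mu]_(x in D) (`|g x - s x|)%:E <= e%:E)%E.
Proof.
move=> mg e0 fg.
have muD : mu D \is a fin_num by rewrite ge0_fin_numE.
have m0 : 0 <= fine (mu D) by exact: fine_ge0.
have m1 : 0 < 2 * (fine (mu D) + 1) by rewrite mulr_gt0// ltr_wpDl.
pose c := e / (2 * (fine (mu D) + 1)); have c0 : 0 < c by rewrite divr_gt0.
have [u [k [mk uk]]] := strongly_measurable_approx mD c0 mg.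
pose s N x := if (k x < N)%N then u (k x) else 0.
have mkS (Y : set nat) : measurable (D `&` k @^-1` Y).
  rewrite (_ : _ `&` _ = \bigcup_(n in Y) (D `&` k @^-1` [set n])).
    exact: bigcup_measurable.
  apply/seteqP; split=> [x [Dx Yx]|x [n Yn [Dx /= kx]]]; first by exists (k x).
  by split => //=; rewrite kx.
have ss N : simple_on D (s N).
  (* The capped index takes finitely many values, and [s N] is a function of it. *)
  have sm : simple_on D (fun x => minn (k x) N).
    split=> [|n]; last exact: (mkS [set m | minn m N = n]).
    apply: (@sub_finite_set _ _ `I_N.+1); last exact: finite_II.
    by move=> _ [x _ <-]; rewrite /= ltnS geq_minr.
  have := simple_on_comp (fun m => if (m < N)%N then u m else 0) sm.
  rewrite (_ : (fun x => _) = s N)//; apply/funext => x.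
  by rewrite /s; case: (ltnP (k x) N) => [kN|Nk]; rewrite ?kN ?ltnn.
pose t N x := if (N <= k x)%N then g x else 0.
have mt N : strongly_measurable D (t N).
  pose F n := if n is 0%N then (fun=> 0) else g.
  have := @strongly_measurable_glue _ _ _ _ D F (fun x => nat_of_bool (N <= k x)%N) mD.
  rewrite (_ : (fun x => _) = t N); last first.
    by apply/funext => x; rewrite /t /F; case: leqP.
  apply=> [n|[|n]] //; last exact: strongly_measurable_cst.
  exact: (mkS [set m | nat_of_bool (N <= m)%N = n]).
have mtE N : measurable_fun D (fun x => (`|t N x|)%:E).
  by apply/measurable_EFinP; exact: strongly_measurable_norm.
have gint : mu.-integrable D (fun x => (`|g x|)%:E).
  apply/integrableP; split.
    by apply/measurable_EFinP; exact: strongly_measurable_norm.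
  by under eq_integral do rewrite abse_EFin normr_id.
have tail : (\int[mu]_(x in D) (`|t N x|)%:E @[N --> \oo] --> 0)%E.
  have := @dominated_convergence _ _ _ mu D mD (fun N x => (`|t N x|)%:E)
    (fun=> 0%E) (fun x => (`|g x|)%:E) mtE (measurable_cst _) _ gint _.
  rewrite integral0 => H; have [] // := H.
    apply: aeW => x Dx; apply: cvg_near_cst.
    exists (k x).+1 => // n /= kn.
    by rewrite /t leqNgt kn /= normr0.
  apply: aeW => x n Dx; rewrite abse_EFin normr_id lee_fin /t.
  by case: ifP => _ //; rewrite normr0.
have [N _ /(_ N (leqnn N)) HN] : \forall N \near \oo,
    (\int[mu]_(x in D) (`|t N x|)%:E <= (e / 2)%:E)%E.
  move/fine_cvgP: tail => [fin /cvgrPdist_le/(_ _ (divr_gt0 e0 (ltr0n _ 2))) cv].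
  apply: filterS2 fin cv => n fn; rewrite sub0r normrN => h.
  by rewrite -(fineK fn) lee_fin (le_trans _ h)// ler_norm.
exists (s N) => //.
have mgs := strongly_measurableB mD mg (simple_on_strongly_measurable mD (ss N)).
apply: (@le_trans _ _ (\int[mu]_(x in D) (c%:E + (`|t N x|)%:E))%E).
  apply: ge0_le_integral => //.
  - by apply/measurable_EFinP; exact: strongly_measurable_norm.
  - by apply: emeasurable_funD.
  - move=> x Dx; rewrite -EFinD lee_fin /s /t.
    case: ltnP => kN; first by rewrite normr0 addr0 ltW// uk.
    by rewrite subr0 lerDr ltW.
rewrite ge0_integralD//; last by move=> x _; rewrite lee_fin ltW.
apply: (@le_trans _ _ ((e / 2)%:E + (e / 2)%:E)%E); last by rewrite -EFinD -splitr.
apply: leeD => //; rewrite (integral_cst mu mD c%:E) -(fineK muD) -EFinM lee_fin.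
rewrite /c mulrAC ler_pdivrMr//.
have -> : e / 2 * (2 * (fine (mu D) + 1)) = e * (fine (mu D) + 1) by field.
by rewrite ler_wpM2l ?(ltW e0)// lerDl.
Qed.

(** Completeness of V enters here: integrals of simple functions within 1 / (n + 1) of g in mean
    form a Cauchy sequence. *)
Lemma bint_exists g : strongly_measurable D g ->
  (\int[mu]_(x in D) (`|g x|)%:E < +oo)%E -> bint g (bochner_integral mu D g).
Proof.
move=> mg fg.
suff [v gv] : exists v, bint g v by rewrite (bint_bochner gv).
have H n : exists s, simple_on D s /\
    (\int[mu]_(x in D) (`|g x - s x|)%:E <= (n.+1%:R^-1)%:E)%E.
  have n0 : 0 < n.+1%:R^-1 :> R by rewrite invr_gt0.
  by have [s ss gs] := simple_approx mg n0 fg; exists s.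
have [s /all_and2[ss gs]] := choice H.
have ms n := simple_on_strongly_measurable mD (ss n).
have sm n m : `|simple_integral mu D (s n) - simple_integral mu D (s m)| <=
    n.+1%:R^-1 + m.+1%:R^-1.
  rewrite -simple_integralB// -lee_fin.
  have ssm : simple_on D (fun x => s n x - s m x).
    exact: (simple_on_comp (fun p => p.1 - p.2) (simple_on_pair (ss n) (ss m))).
  apply: le_trans (simple_integral_norm ssm) _; rewrite EFinD.
  apply: le_trans (integral_norm_le2 mD _ (strongly_measurableB mD mg (ms n))
    (strongly_measurableB mD mg (ms m)) _) (leeD (gs n) (gs m)).
    exact: strongly_measurableB.
  move=> x _; have -> : s n x - s m x = (g x - s m x) - (g x - s n x) by lmod R.
  by rewrite [leRHS]addrC; exact: ler_normB.
have cv : cvgn (fun n => simple_integral mu D (s n)).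
  apply: cvgn_of_cauchy => e e0.
  have [N _ /(_ N (leqnn N)) /= Ne] :=
    near_infty_natSinv_lt (PosNum (divr_gt0 e0 (ltr0n _ 2))).
  exists N => n Nn; apply: le_lt_trans (sm N n) _.
  rewrite [e]splitr; apply: ltr_leD => //; apply: le_trans (ltW Ne).
  by rewrite lef_pV2 ?posrE// ler_nat.
exists (limn (fun n => simple_integral mu D (s n))); split => // e e0.
have /cvgrPdist_le/(_ e e0) sl := cv.
have [N _ /(_ N (leqnn N)) /= [h1 h2]] :
    \forall n \near \oo, `|limn (fun n => simple_integral mu D (s n)) -
      simple_integral mu D (s n)| <= e /\ n.+1%:R^-1 < e.
  by apply: filterS2 sl (near_infty_natSinv_lt (PosNum e0)).
exists (s N); split => //; last by rewrite distrC.
by apply: le_trans (gs N) _; rewrite lee_fin ltW.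
Qed.

End finite_domain.
End bochner_theory.

(** * Integrals over intervals *)

Section interval_integrals.
Context (R : realType) (V : completeNormedModType R).
Let TR : measurableType _ := measurableTypeR R.
Let mu : {measure set TR -> \bar R} := @lebesgue_measure R.
Implicit Types (a b c e r : R) (g h : R -> V) (v w : V).

(** One simple function close to g in mean on the union is close on both parts, and its own integral
    is additive; this leaves three errors of at most e. *)
Lemma bint_setU (E F : set TR) g z v w : measurable E -> measurable F ->
  (mu (E `|` F) < +oo)%E -> [disjoint E & F] ->
  bint mu (E `|` F) g z -> bint mu E g v -> bint mu F g w -> z = v + w.
Proof.
move=> mE mF fEF EF [mg Hz] gv gw.
have mEF : measurable (E `|` F) by exact: measurableU.
have sE : E `<=` E `|` F by exact: subsetUl.
have sF : F `<=` E `|` F by exact: subsetUr.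
have fin A : measurable A -> A `<=` E `|` F -> (mu A < +oo)%E.
  by move=> mA AEF; apply: le_lt_trans fEF; apply: le_measure; rewrite ?inE.
apply/eqP; rewrite -subr_eq0; apply/eqP; apply: (@norm_le_eps_eq0 _ _ _ 3) => e e0.
have [s [ss gs sz]] := Hz e e0.
have close A x : measurable A -> A `<=` E `|` F -> bint mu A g x ->
    `|x - simple_integral mu A s| <= e.
  move=> mA AEF gx; have fA := fin _ mA AEF.
  have sA := simple_on_subset mA AEF ss.
  rewrite -lee_fin; apply: le_trans gs.
  have h := bint_norm mA fA (bintB mA fA gx (bint_simple mu mA sA)).
  apply: le_trans h _.
  apply: ge0_subset_integral => //.
  apply/measurable_EFinP; apply: strongly_measurable_norm => //.
  by apply: strongly_measurableB => //; exact: simple_on_strongly_measurable.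
have hv := close E v mE sE gv; have hw := close F w mF sF gw.
have sU := simple_integral_setU mEF fEF ss mE mF sE sF EF.
have -> : z - (v + w) = (z - simple_integral mu (E `|` F) s) -
   (v - simple_integral mu E s) - (w - simple_integral mu F s).
  by rewrite sU; lmod R.
apply: le_trans (ler_normB _ _) _.
have := ler_normB (z - simple_integral mu (E `|` F) s) (v - simple_integral mu E s).
rewrite (distrC z); lra.
Qed.

Definition integrable_on a b g := strongly_measurable (`[a, b]%classic : set TR) g /\
  (\int[mu]_(r in `[a, b]) (`|g r|)%:E < +oo)%E.

Definition integral_on a b g := bochner_integral mu `[a, b]%classic g.

Definition norm_integral a b g := fine (\int[mu]_(r in `[a, b]) (`|g r|)%:E)%E.

Lemma mitv a b : measurable (`[a, b]%classic : set TR).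
Proof. exact: measurable_itv. Qed.
Hint Resolve mitv : core.

Lemma lebesgue_itv a b :
  mu `[a, b]%classic = (if (a < b)%R then b%:E - a%:E else 0)%E.
Proof. by apply: etrans (lebesgue_measure_itv `[a, b]) _; rewrite /= lte_fin. Qed.

Lemma itv_finite a b : (mu `[a, b]%classic < +oo)%E.
Proof. by rewrite lebesgue_itv; case: ifP => _; rewrite ?ltry// -EFinB ltry. Qed.

Lemma itv_subset a b a' b' : a <= a' -> b' <= b ->
  (`[a', b']%classic : set TR) `<=` (`[a, b]%classic : set TR).
Proof. by move=> aa bb x /=; rewrite !in_itv /=; lra. Qed.

Lemma norm_measurable a b g : strongly_measurable (`[a, b]%classic : set TR) g ->
  measurable_fun (`[a, b]%classic : set TR) (fun r => (`|g r|)%:E).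
Proof. by move=> mg; apply/measurable_EFinP; exact: strongly_measurable_norm. Qed.

Lemma integrable_on_subset a b a' b' g : a <= a' -> b' <= b ->
  integrable_on a b g -> integrable_on a' b' g.
Proof.
move=> aa bb [mg fg]; have s := itv_subset aa bb; split.
  by apply: strongly_measurable_subset mg.
apply: le_lt_trans fg; apply: ge0_subset_integral => //.
exact: norm_measurable.
Qed.

Lemma norm_integralE a b g : integrable_on a b g ->
  (\int[mu]_(r in `[a, b]) (`|g r|)%:E)%E = (norm_integral a b g)%:E.
Proof. by move=> [_ fg]; rewrite fineK// ge0_fin_numE// integral_ge0. Qed.

Lemma norm_integral_ge0 a b g : 0 <= norm_integral a b g.
Proof. by rewrite fine_ge0// integral_ge0. Qed.

Lemma integral_on_bint a b g : integrable_on a b g ->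
  bint mu `[a, b]%classic g (integral_on a b g).
Proof. by move=> [mg fg]; apply: bint_exists => //; exact: itv_finite. Qed.

Lemma integral_on_eq a b g v : bint mu `[a, b]%classic g v -> integral_on a b g = v.
Proof. by move=> gv; apply: bint_bochner => //; exact: itv_finite. Qed.

Lemma integral_on_norm a b g : integrable_on a b g ->
  `|integral_on a b g| <= norm_integral a b g.
Proof.
move=> ig; rewrite -lee_fin -norm_integralE//.
by apply: bint_norm (integral_on_bint ig) => //; exact: itv_finite.
Qed.

(** Either [xget] returns its default 0, or the value has norm at most an integral over a single
    point. *)
Lemma integral_on_point a g : integral_on a a g = 0.
Proof.
rewrite /integral_on /bochner_integral; case: xgetP => [v _|//].
move=> /(bintP (mitv _ _) (itv_finite a a)) gv.
have := bint_norm (mitv _ _) (itv_finite a a) gv.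
by rewrite set_itv1 integral_set1 lee_fin normr_le0 => /eqP.
Qed.

(** The two closed intervals share the point b, so [a, c] is split into [a, b] and ]b, c], and the
    null set {b} is restored to the second part. *)
Lemma integral_on_cat a b c g : a <= b -> b <= c -> integrable_on a c g ->
  integral_on a c g = integral_on a b g + integral_on b c g.
Proof.
move=> ab bc ig.
have split_l (x y : R) : x <= y ->
    (`[x, y]%classic : set TR) = [set x] `|` `]x, y]%classic.
  move=> xy; apply/seteqP; split=> r /=; rewrite !in_itv /=.
    move=> /andP[xr ry]; have [->|rx] := eqVneq r x; [by left|right].
    by rewrite lt_neqAle eq_sym rx xr ry.
  by move=> [->|/andP[xr ry]]; rewrite ?lexx ?xy// ry ltW.
have ig1 := integrable_on_subset (lexx a) bc ig.
have ig2 := integrable_on_subset ab (lexx c) ig.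
have gbc := integral_on_bint ig2.
have sub A : A `<=` (`[a, c]%classic : set TR) -> measurable A ->
    exists v, bint mu A g v.
  move=> AS mA; exists (bochner_integral mu A g); apply: bint_exists => //.
  - by apply: le_lt_trans (itv_finite a c); apply: le_measure; rewrite ?inE.
  - by apply: strongly_measurable_subset ig.1.
  - apply: le_lt_trans ig.2; apply: ge0_subset_integral => //.
    by apply: norm_measurable; exact: ig.1.
have [w gw] : exists w, bint mu (`]b, c]%classic : set TR) g w.
  by apply: sub => // r /=; rewrite !in_itv /=; lra.
have [p gp] : exists p, bint mu [set b] g p.
  by apply: sub => // r /= ->; rewrite in_itv /= ab bc.
have p0 : p = 0.
  have mb : measurable ([set b] : set TR) by exact: measurable_set1.
  have := bint_norm mb _ gp.
  rewrite integral_set1 [mu _]lebesgue_measure_set1 => /(_ (ltry _)).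
  by rewrite lee_fin normr_le0 => /eqP.
have -> : integral_on b c g = w.
  have fbc := itv_finite b c; rewrite split_l// in fbc gbc.
  rewrite (bint_setU _ _ fbc _ gbc gp gw) ?p0 ?add0r//.
  by apply/disj_set2P/seteqP; split => // r [/= -> /=]; rewrite in_itv /= ltxx.
have eac : (`[a, c]%classic : set TR) = `[a, b]%classic `|` `]b, c]%classic.
  apply/seteqP; split=> r /=; rewrite !in_itv /=.
    by move=> /andP[-> ->]; rewrite andbT /=; have [rb|br] := leP r b; [left|right].
  by move=> [/andP[ar rb]|/andP[br rc]]; lra.
have gac := integral_on_bint ig; have fac := itv_finite a c.
rewrite eac in gac fac.
apply: (bint_setU _ _ fac _ gac (integral_on_bint ig1) gw) => //.
apply/disj_set2P/seteqP; split => // r [/=]; rewrite !in_itv /= => /andP[_ rb] /andP[br _].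
by move: rb; rewrite leNgt br.
Qed.

Lemma norm_integral_cat a b c g : a <= b -> b <= c -> integrable_on a c g ->
  norm_integral a c g = norm_integral a b g + norm_integral b c g.
Proof.
move=> ab bc ig.
have ig1 := integrable_on_subset (lexx a) bc ig.
have ig2 := integrable_on_subset ab (lexx c) ig.
apply: EFin_inj; rewrite EFinD -!norm_integralE//.
have eac : (`[a, c]%classic : set TR) = `[a, b]%classic `|` `]b, c]%classic.
  apply/seteqP; split=> r /=; rewrite !in_itv /=.
    by move=> /andP[-> ->]; rewrite andbT /=; have [rb|br] := leP r b; [left|right].
  by move=> [/andP[ar rb]|/andP[br rc]]; lra.
have mg := norm_measurable ig.1.
rewrite {1}eac ge0_integral_setU//; last 2 first.
- by rewrite -eac.
- apply/disj_set2P/seteqP; split => // r [/=].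
  by rewrite !in_itv /= => /andP[_ rb] /andP[br _]; move: rb; rewrite leNgt br.
congr (_ + _)%E; apply: integral_itv_obnd_cbnd.
apply: measurable_funS mg => // r /=.
by rewrite !in_itv /=; lra.
Qed.

Lemma integrable_on_le a b g h k : strongly_measurable (`[a, b]%classic : set TR) g ->
  integrable_on a b h -> 0 <= k ->
  (forall r, a <= r -> r <= b -> `|g r| <= k * `|h r|) ->
  integrable_on a b g /\ norm_integral a b g <= k * norm_integral a b h.
Proof.
move=> mg ih k0 gh.
have le : (\int[mu]_(r in `[a, b]) (`|g r|)%:E <= (k * norm_integral a b h)%:E)%E.
  have mh := norm_measurable ih.1.
  rewrite EFinM -norm_integralE// -ge0_integralZl_EFin//.
  apply: ge0_le_integral => //; first exact: norm_measurable.
    exact: measurable_funeM.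
  by move=> r; rewrite /= in_itv /= => /andP[ar rb]; rewrite -EFinM lee_fin gh.
have ig : integrable_on a b g by split => //; apply: le_lt_trans le (ltry _).
by split => //; rewrite -lee_fin -norm_integralE.
Qed.

Lemma integrable_on_cst a b v : integrable_on a b (fun=> v).
Proof.
split; first exact: strongly_measurable_cst.
rewrite (integral_cst mu (mitv _ _) (`|v|)%:E).
have fin : mu `[a, b]%classic \is a fin_num by rewrite ge0_fin_numE ?itv_finite.
by rewrite -(fineK fin) -EFinM ltry.
Qed.

Lemma itv_measure a b : a <= b -> fine (mu `[a, b]%classic) = b - a.
Proof.
move=> ab; rewrite lebesgue_itv.
by move: ab; rewrite le_eqVlt => /predU1P[->|->]//; rewrite ltxx subrr.
Qed.

Lemma integral_on_cst a b v : a <= b -> integral_on a b (fun=> v) = (b - a) *: v.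
Proof.
move=> ab; apply: integral_on_eq.
have sv : simple_on (`[a, b]%classic : set TR) (fun=> v).
  split=> [|w].
    by apply: (@sub_finite_set _ _ [set v]) => // _ [r _ <-].
  by apply: measurableI => //; rewrite preimage_cst; case: ifP.
have := bint_simple mu (mitv _ _) sv.
by rewrite (@simple_integral_cst _ _ _ _ _ _ _ v)// itv_measure.
Qed.

Lemma integral_on_bound a b g M : a <= b -> integrable_on a b g -> 0 <= M ->
  (forall r, a <= r -> r <= b -> `|g r| <= M) ->
  `|integral_on a b g| <= M * (b - a).
Proof.
move=> ab ig M0 gM; apply: le_trans (integral_on_norm ig) _.
have fin : mu `[a, b]%classic \is a fin_num by rewrite ge0_fin_numE ?itv_finite.
rewrite -lee_fin -norm_integralE// -(itv_measure ab) EFinM fineK//.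
rewrite -(integral_cst mu (mitv _ _) M%:E).
apply: ge0_le_integral => //; first exact: norm_measurable ig.1.
by move=> r; rewrite /= in_itv /= => /andP[ar rb]; rewrite lee_fin gM.
Qed.

Lemma integrable_onB a b g h : integrable_on a b g -> integrable_on a b h ->
  integrable_on a b (fun r => g r - h r) /\
  integral_on a b (fun r => g r - h r) = integral_on a b g - integral_on a b h.
Proof.
move=> ig ih; split; last first.
  apply: integral_on_eq; apply: bintB => //; [exact: itv_finite|
    exact: integral_on_bint|exact: integral_on_bint].
have mB := strongly_measurableB (mitv _ _) ig.1 ih.1.
split => //; apply: le_lt_trans (lte_add_pinfty ig.2 ih.2).
by apply: (integral_norm_le2 mu (mitv _ _) mB ig.1 ih.1) => r _; exact: ler_normB.
Qed.

Lemma integral_on_linear a b g (L : {linear V -> V}) C :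
  (forall x, `|L x| <= C * `|x|) -> integrable_on a b g ->
  integral_on a b (fun r => L (g r)) = L (integral_on a b g).
Proof.
move=> LC ig; apply: integral_on_eq.
by apply: bint_linear LC (integral_on_bint ig) => //; exact: itv_finite.
Qed.

Lemma norm_integral_small a b g : integrable_on a b g -> forall e, 0 < e ->
  exists2 d, 0 < d & forall u v : R, a <= u -> u <= v -> v <= b ->
    v - u < d -> norm_integral u v g < e.
Proof.
move=> ig e e0.
(* Extension by 0 to the whole line, where absolute continuity of the integral is applied. *)
pose fab := (fun r => `|g r|) \_ `[a, b].
have intf : mu.-integrable setT (EFin \o fab).
  rewrite -restrict_EFin; apply/integrable_restrict => //=; rewrite setTI.
  apply/integrableP; split; first exact: norm_measurable ig.1.
  by under eq_integral do rewrite /= normr_id; exact: ig.2.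
have [d [d0 Hd]] := integral_normr_continuous intf e0.
exists d => // u v au uv vb vud.
have := Hd `[u, v]%classic (mitv _ _).
rewrite lebesgue_itv => Huv.
have {Huv} := Huv _; rewrite /norm_integral /Rintegral => Huv.
have -> : (\int[mu]_(r in `[u, v]) (`|g r|)%:E =
    \int[mu]_(r in `[u, v]) (`|fab r|)%:E)%E.
  apply: eq_integral => r; rewrite inE /= in_itv /= => /andP[ur rv].
  by rewrite /fab patchE ifT ?normr_id// inE /= in_itv /=; lra.
apply: Huv; case: ifP => _; last by rewrite lte_fin.
by rewrite -EFinB lte_fin.
Qed.

Definition continuous_on a b g := forall c, a <= c -> c <= b -> forall e, 0 < e ->
  exists2 d, 0 < d & forall r, a <= r -> r <= b -> `|r - c| < d -> `|g r - g c| < e.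

Lemma continuous_on_bounded a b g : a <= b -> continuous_on a b g ->
  exists2 M, 0 < M & forall r, a <= r -> r <= b -> `|g r| <= M.
Proof.
move=> ab cg.
pose P (u v : R) := exists2 M, 0 < M & forall r, u <= r -> r <= v -> `|g r| <= M.
apply: (@cousin R P a b) => //.
  move=> u v w au uv vw wb [M M0 HM] [N N0 HN]; exists (M + N).
    by rewrite addr_gt0.
  move=> r ur rw; have [rv|/ltW vr] := leP r v.
    by apply: le_trans (HM r ur rv) _; rewrite lerDl ltW.
  by apply: le_trans (HN r vr rw) _; rewrite lerDr ltW.
move=> c ac cb; have [d d0 Hd] := cg c ac cb 1 ltr01.
exists d => // u v au uc cv vb vud; exists (1 + `|g c|); first by rewrite ltr_wpDr.
move=> r ur rv; rewrite -[g r](subrK (g c)); apply: le_trans (ler_normD _ _) _.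
by rewrite lerD// ltW// Hd//; first (lra); first (lra); rewrite ltr_norml; lra.
Qed.

(** Cousin's lemma replaces uniform continuity: near a tag c the constant g c is an approximation,
    and approximations on adjacent intervals are joined. *)
Lemma continuous_on_measurable a b g : a <= b -> continuous_on a b g ->
  strongly_measurable (`[a, b]%classic : set TR) g.
Proof.
move=> ab cg; apply: strongly_measurable_of_approx => // e e0.
pose P (u v : R) := countably_approx (`[u, v]%classic : set TR) g e.
apply: (@cousin R P a b) => //.
  move=> u v w au uv vw wb [p [k [mk pk]]] [q [l [ml ql]]].
  (* Odd indices serve [u, v] and even ones ]v, w]; the common point v goes to the left. *)
  exists (fun n => if odd n then p n./2 else q n./2).
  exists (fun r => if r <= v then (k r).*2.+1 else (l r).*2).
  split=> [n|r /=]; last first.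
    rewrite in_itv /= => /andP[ur rw]; have [rv|vr] := leP r v.
      rewrite /= odd_double /= uphalf_double; apply: pk => /=.
      by rewrite in_itv /= ur rv.
    rewrite odd_double doubleK; apply: ql => /=.
    by rewrite in_itv /= rw ltW.
  rewrite (_ : _ `&` _ =
    (`[u, v] `&` k @^-1` [set m | m.*2.+1 = n]) `|`
    (`]v, w] `&` (`[v, w] `&` l @^-1` [set m | m.*2 = n]))).
    have mm (D : set TR) (j : R -> nat) (Y : set nat) : measurable D ->
        (forall n, measurable (D `&` j @^-1` [set n])) ->
        measurable (D `&` j @^-1` Y).
      move=> mD mj.
      rewrite (_ : _ `&` _ = \bigcup_(n in Y) (D `&` j @^-1` [set n])).
        exact: bigcup_measurable.
      apply/seteqP; split=> [x [Dx Yx]|x [i Yi [Dx /= jx]]]; first by exists (j x).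
      by split => //=; rewrite jx.
    apply: measurableU; first exact: mm.
    by apply: measurableI => //; exact: mm.
  apply/seteqP; split=> r /=; rewrite !in_itv /=.
    move=> [/andP[ur rw]]; case: leP => [rv|vr] kl; first by left; rewrite ur.
    by right; rewrite rw (ltW vr).
  move=> [[/andP[ur rv] kn]|[/andP[vr rw] [_ ln]]].
    by rewrite ur rv (le_trans rv vw).
  by rewrite rw (le_trans uv (ltW vr)) leNgt vr.
move=> c ac cb; have [d d0 Hd] := cg c ac cb e e0.
exists d => // u v au uc cv vb vud.
exists (fun=> g c), (fun=> 0%N); split=> [n|r /=].
  by apply: measurableI => //; rewrite preimage_cst; case: ifP.
by rewrite in_itv /= => /andP[ur rv]; apply: Hd; [lra|lra|rewrite ltr_norml; lra].
Qed.

Lemma continuous_on_integrable a b g : a <= b -> continuous_on a b g ->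
  integrable_on a b g.
Proof.
move=> ab cg; have mg := continuous_on_measurable ab cg.
have [M M0 gM] := continuous_on_bounded ab cg.
split => //; apply: (@le_lt_trans _ _ (\int[mu]_(r in `[a, b]) (cst M%:E) r)%E).
  apply: ge0_le_integral => //; first exact: norm_measurable mg.
  by move=> r; rewrite /= in_itv /= => /andP[ar rb]; rewrite lee_fin gM.
rewrite integral_cst//.
have fin : mu `[a, b]%classic \is a fin_num by rewrite ge0_fin_numE ?itv_finite.
by rewrite -(fineK fin) -EFinM ltry.
Qed.

End interval_integrals.

Section integral_estimates.
Context (R : realType) (V : completeNormedModType R).
Implicit Types (a b c e r u v : R) (g h p : R -> V) (x : V).

Lemma tag_dist u c v r : u <= c -> c <= v -> u <= r -> r <= v ->
  `|r - c| <= v - u.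
Proof. by move=> *; rewrite ler_norml; lra. Qed.

(** Constants of [local_increment]: tau is v - u, n is the integral of |E|, and q1 and q2 are the
    norms of a - b - J and a - b. *)
Lemma increment_budget (eta eps K tau n q1 q2 : R) : 0 <= tau -> 0 <= n ->
  0 <= K -> 0 < eps -> eps <= 1 -> eps * (2 + 2 * K) <= eta ->
  q1 <= 2 * eps * tau -> q2 <= q1 + n ->
  eps * q2 + K * q1 + eps * n <= eta * (tau + n).
Proof.
move=> tau0 n0 K0 eps0 eps1 epsK h1 h2.
have h3 : eps * q2 <= eps * (2 * tau + n).
  rewrite ler_wpM2l ?(ltW eps0)//; apply: le_trans h2 _; rewrite lerD2r.
  by apply: le_trans h1 _; rewrite ler_wpM2r// ler_piMr.
have h4 := ler_wpM2l K0 h1.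
have h5 : eps * (2 + 2 * K) * (tau + n) <= eta * (tau + n).
  by rewrite ler_wpM2r// addr_ge0.
have h6 : 0 <= eps * K * n by rewrite !mulr_ge0// ltW.
lra.
Qed.

Lemma integral_on_near_cst u v g x e : u <= v -> 0 <= e -> integrable_on u v g ->
  (forall r, u <= r -> r <= v -> `|g r - x| <= e) ->
  `|integral_on u v g - (v - u) *: x| <= e * (v - u).
Proof.
move=> uv e0 ig gx; have [igx <-] : integrable_on u v (fun r => g r - x) /\
    integral_on u v (fun r => g r - x) = integral_on u v g - (v - u) *: x.
  have [? ->] := integrable_onB ig (integrable_on_cst u v x).
  by rewrite integral_on_cst.
exact: integral_on_bound.
Qed.

Lemma continuous_on_subset a b a' b' g : a <= a' -> b' <= b ->
  continuous_on a b g -> continuous_on a' b' g.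
Proof.
move=> aa bb cg c ac cb e e0.
have [d d0 Hd] := cg c (le_trans aa ac) (le_trans cb bb) e e0.
by exists d => // r ar rb; apply: Hd; [exact: le_trans ar|exact: le_trans rb bb].
Qed.

Lemma integral_equation_deriv a b g p x : continuous_on a b g ->
  (forall t, a <= t -> t <= b -> p t = x + integral_on a t g) ->
  forall c, a <= c -> c <= b -> tagged_deriv a b p c (g c).
Proof.
move=> cg pE c ac cb e e0; have [d d0 Hd] := cg c ac cb e e0.
exists d => // u v au uc cv vb vud; have uv := le_trans uc cv.
have ub : u <= b by exact: le_trans cb.
have av : a <= v by exact: le_trans cv.
have ig : integrable_on a v g.
  apply: continuous_on_integrable => //.
  by apply: continuous_on_subset cg.
rewrite (pE v av vb) (pE u au ub) (integral_on_cat au uv ig).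
have -> : x + (integral_on a u g + integral_on u v g) - (x + integral_on a u g)
  - (v - u) *: g c = integral_on u v g - (v - u) *: g c by lmod R.
apply: integral_on_near_cst => //; first exact: ltW.
  exact: integrable_on_subset ig.
move=> r ur rv; apply: ltW; apply: Hd; [lra|lra|].
by rewrite ltr_norml; lra.
Qed.

End integral_estimates.

(** * The variation formula *)

Section alekseev_groebner.
Context (R : realType) (V : completeNormedModType R) (T : R) (T_ge0 : 0 <= T).
Context (f : R -> V -> V).
Implicit Types (a b c e r s t u v : R) (x y h : V).
Context (f_diff : forall t, 0 <= t -> t <= T -> forall x, differentiable (f t) x).
Context (f_cont : forall c y, 0 <= c -> c <= T -> forall e, 0 < e ->
  exists2 d : R, 0 < d & forall r x, 0 <= r -> r <= T -> `|r - c| < d ->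
    `|x - y| < d -> `|f r x - f c y| <= e).
Context (df_cont : forall c y, 0 <= c -> c <= T -> forall e, 0 < e ->
  exists2 d : R, 0 < d & forall r x, 0 <= r -> r <= T -> `|r - c| < d ->
    `|x - y| < d -> forall h, `|'d (f r) x h - 'd (f c) y h| <= e * `|h|).
Context (X : R -> R -> V -> V).
Context (X_cont : forall s x, 0 <= s -> s <= T -> continuous_on s T (fun t => X s t x)).
Context (X_sol : forall s t x, 0 <= s -> s <= t -> t <= T ->
  X s t x = x + integral_on s t (fun r => f r (X s r x))).
Context (Y E : R -> V).
Context (Y_meas : strongly_measurable (`[0, T]%classic : set (measurableTypeR R)) Y).
Context (E_int : integrable_on 0 T E).
Context (fY_int : (\int[@lebesgue_measure R]_(r in `[0%R, T])
  (`|f r (Y r)|)%:E < +oo)%E).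
Context (Y_eq : forall t, 0 <= t -> t <= T ->
  Y t = Y 0 + integral_on 0 t (fun r => f r (Y r) + E r)).

Lemma continuous_on_field a b (p : R -> V) : 0 <= a -> b <= T ->
  continuous_on a b p -> continuous_on a b (fun r => f r (p r)).
Proof.
move=> a0 bT cp c ac cb e e0.
have e20 : 0 < e / 2 by rewrite divr_gt0.
have [d d0 Hd] := f_cont (p c) (le_trans a0 ac) (le_trans cb bT) e20.
have [d' d'0 Hd'] := cp c ac cb d d0.
exists (Num.min d d'); first by rewrite lt_min d0.
move=> r ar rb; rewrite lt_min => /andP[rd rd'].
apply: (@le_lt_trans _ _ (e / 2)); last by rewrite ltr_pdivrMr// ltr_pMr// ltr1n.
by apply: Hd => //; [exact: le_trans ar|exact: le_trans bT|exact: Hd'].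
Qed.

Lemma X_deriv s x c : 0 <= s -> s <= c -> c <= T ->
  tagged_deriv s T (fun r => X s r x) c (f c (X s c x)).
Proof.
move=> s0 sc cT; have sT := le_trans sc cT.
have cf := continuous_on_field s0 (lexx T) (X_cont x s0 sT).
by apply: (integral_equation_deriv cf) => // t st tT; exact: X_sol.
Qed.

Lemma X_start s x : 0 <= s -> s <= T -> X s s x = x.
Proof. by move=> s0 sT; rewrite X_sol// integral_on_point addr0. Qed.

(** Continuity of Y cannot be used here: it is deduced below from integrability of the right-hand
    side, which rests on this lemma. *)
Lemma field_measurable : strongly_measurable
  (`[0, T]%classic : set (measurableTypeR R)) (fun r => f r (Y r)).
Proof.
apply: (strongly_measurable_caratheodory (F := f) (mitv 0 T)) => //.
- move=> v; apply: continuous_on_measurable => //.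
  apply: (continuous_on_field (lexx 0) (lexx T) (p := fun=> v)) => c c0 cT e e0.
  by exists 1 => // r _ _ _; rewrite subrr normr0.
- move=> r /=; rewrite in_itv /= => /andP[r0 rT] y e e0.
  have e20 : 0 < e / 2 by rewrite divr_gt0.
  have [d d0 Hd] := f_cont y r0 rT e20.
  exists d => // y' yy'; apply: (@le_lt_trans _ _ (e / 2)).
    by apply: Hd => //; rewrite subrr normr0.
  by rewrite ltr_pdivrMr// ltr_pMr// ltr1n.
Qed.

Lemma field_integrable : integrable_on 0 T (fun r => f r (Y r)).
Proof. by split; first exact: field_measurable. Qed.

Let g r := f r (Y r) + E r.

Lemma rhs_integrable : integrable_on 0 T g.
Proof.
have mg : strongly_measurable (`[0, T]%classic : set (measurableTypeR R)) g.
  by apply: strongly_measurableD; [exact: mitv|exact: field_measurable|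
    exact: E_int.1].
split => //; apply: le_lt_trans (lte_add_pinfty fY_int E_int.2).
apply: (integral_norm_le2 _ (mitv 0 T) mg field_measurable E_int.1).
by move=> r _; exact: ler_normD.
Qed.

Lemma Y_increment u v : 0 <= u -> u <= v -> v <= T ->
  Y v - Y u = integral_on u v g.
Proof.
move=> u0 uv vT; have v0 := le_trans u0 uv; have uT := le_trans uv vT.
have ig : integrable_on 0 v g by exact: integrable_on_subset rhs_integrable.
have YE r : 0 <= r -> r <= T -> Y r = Y 0 + integral_on 0 r g := @Y_eq r.
rewrite (YE v v0 vT) (YE u u0 uT) (integral_on_cat u0 uv ig).
set I := integral_on 0 u g.
by lmod R.
Qed.

Lemma Y_cont : continuous_on 0 T Y.
Proof.
move=> c c0 cT e e0.
have [d d0 Hd] := norm_integral_small rhs_integrable e0.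
exists d => // r r0 rT rc.
have key u v : 0 <= u -> u <= v -> v <= T -> v - u < d -> `|Y v - Y u| < e.
  move=> u0 uv vT vud; rewrite Y_increment//.
  apply: le_lt_trans (integral_on_norm _) (Hd u v u0 uv vT vud).
  exact: integrable_on_subset rhs_integrable.
have [cr|/ltW rc'] := leP c r.
  by apply: key => //; rewrite ger0_norm ?subr_ge0 in rc.
by rewrite distrC; apply: key => //; rewrite distrC ger0_norm ?subr_ge0 in rc.
Qed.

Section fixed_end.
Context (t : R) (t_ge0 : 0 <= t) (t_le : t <= T).

Let G r : {linear V -> V} := 'd (X r t) (Y r).

Lemma X_differentiable r x : 0 <= r -> r <= t -> differentiable (X r t) x.
Proof.
move=> r0 rt.
by have [] := flow_differentiable f_diff f_cont df_cont X_deriv X_start x r0 rt t_le.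
Qed.

Lemma G_cont c : 0 <= c -> c <= t -> forall e, 0 < e -> exists2 d : R, 0 < d &
  forall r, 0 <= r -> r <= t -> `|r - c| < d ->
  forall h, `|G r h - G c h| <= e * `|h|.
Proof.
move=> c0 ct e e0.
have [d d0 Hd] := flow_derivative_continuous f_diff f_cont df_cont X_deriv
  X_start (Y c) c0 ct t_le e0.
have [d' d'0 Hd'] := Y_cont c0 (le_trans ct t_le) d0.
exists (Num.min d d'); first by rewrite lt_min d0.
move=> r r0 rt; rewrite lt_min => /andP[rd rd'] h; apply: Hd => //.
by apply: Hd' => //; exact: le_trans t_le.
Qed.

Lemma G_bound r : 0 <= r -> r <= t ->
  exists2 K : R, 0 < K & forall h, `|G r h| <= K * `|h|.
Proof. by move=> r0 rt; apply: differentiable_bound; exact: X_differentiable. Qed.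

Lemma G_bounded : exists2 K : R, 0 < K & forall r, 0 <= r -> r <= t ->
  forall h, `|G r h| <= K * `|h|.
Proof.
pose P u v := exists2 K : R, 0 < K & forall r, u <= r -> r <= v ->
  forall h, `|G r h| <= K * `|h|.
apply: (@cousin R P 0 t) => // [u v w _ uv vw _ [K K0 HK] [L L0 HL]|c c0 ct].
  exists (K + L); first by rewrite addr_gt0.
  move=> r ur rw h; rewrite mulrDl; have [rv|/ltW vr] := leP r v.
    by apply: le_trans (HK r ur rv h) _; rewrite lerDl mulr_ge0// ltW.
  by apply: le_trans (HL r vr rw h) _; rewrite lerDr mulr_ge0// ltW.
have [K K0 HK] := G_bound c0 ct.
have [d d0 Hd] := G_cont c0 ct ltr01.
exists d => // u v u0 uc cv vt vud; exists (1 + K); first by rewrite addr_gt0.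
move=> r ur rv h; rewrite -[G r h](subrK (G c h)) mulrDl.
apply: le_trans (ler_normD _ _) _; apply: lerD => //.
by apply: Hd; [lra|lra|rewrite ltr_norml; lra].
Qed.

(** E is only measurable, so the product with G is treated as a Carathéodory function: continuous in
    r for a fixed vector, and continuous in the vector by the bound on G. *)
Lemma GE_measurable : strongly_measurable
  (`[0, t]%classic : set (measurableTypeR R)) (fun r => G r (E r)).
Proof.
have [K K0 HK] := G_bounded.
apply: (strongly_measurable_caratheodory (F := fun r x => G r x) (g := E)
  (mitv 0 t)) => //.
- move=> x; apply: continuous_on_measurable => // c c0 ct e e0.
  have x0 : 0 < `|x| + 1 by rewrite ltr_wpDl.
  have [d d0 Hd] := G_cont c0 ct (divr_gt0 e0 x0).
  exists d => // r r0 rt rc; apply: le_lt_trans (Hd r r0 rt rc x) _.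
  by rewrite mulrAC ltr_pdivrMr// ltr_pM2l// ltrDl.
- move=> r /=; rewrite in_itv /= => /andP[r0 rt] y e e0.
  exists (e / K); first by rewrite divr_gt0.
  move=> y' yy'; rewrite -linearB; apply: le_lt_trans (HK r r0 rt _) _.
  by rewrite mulrC -ltr_pdivlMr.
- by have [] := integrable_on_subset (lexx 0) t_le E_int.
Qed.

Lemma GE_integrable : integrable_on 0 t (fun r => G r (E r)).
Proof.
have [K K0 HK] := G_bounded.
have iE := integrable_on_subset (lexx 0) t_le E_int.
have [] := integrable_on_le GE_measurable iE (ltW K0) _ => //.
by move=> r r0 rt; exact: HK.
Qed.

Let W u v := integral_on u v (fun r => G r (E r)).

(** With a = Y v, b = X u v (Y u) and J the integral of E, there are three errors: linearising the
    flow at (c, Y c) costs eps |a - b|, replacing a - b by J costs 2 K eps (v - u), and replacing G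
    r by G c under the integral costs eps times the integral of |E|. *)
Lemma local_increment c eta : 0 <= c -> c <= t -> 0 < eta ->
  exists2 d : R, 0 < d & forall u v, 0 <= u -> u <= c -> c <= v -> v <= t ->
    v - u < d -> `|X v t (Y v) - X u t (Y u) - W u v| <=
      eta * (v - u + norm_integral u v E).
Proof.
move=> c0 ct eta0; have cT := le_trans ct t_le.
have [K K0 HK] := G_bound c0 ct.
pose eps := Num.min 1 (eta / (2 + 2 * K)).
have K2 : 0 < 2 + 2 * K by rewrite addr_gt0// mulr_gt0.
have eps0 : 0 < eps by rewrite lt_min ltr01 divr_gt0.
have eps1 : eps <= 1 by rewrite ge_min lexx.
have epsK : eps * (2 + 2 * K) <= eta.
  by rewrite -ler_pdivlMr// ge_min lexx orbT.
have [d1 d10 H1] := flow_short_time f_cont X_deriv X_start (Y c) c0 cT eps0.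
have [_ /(_ _ eps0)[d2 d20 H2]] :=
  flow_differentiable f_diff f_cont df_cont X_deriv X_start (Y c) c0 ct t_le.
have [d3 d30 H3] := flow_stays_near f_cont X_deriv X_start (Y c) c0 cT d20.
have [d4 d40 H4] := G_cont c0 ct eps0.
have cfY := continuous_on_field (lexx 0) (lexx T) Y_cont.
have [d5 d50 H5] := cfY c c0 cT eps eps0.
pose d6 := Num.min d1 (Num.min d2 d3); have d60 : 0 < d6 by rewrite !lt_min d10 d20.
have [d7 d70 H7] := Y_cont c0 cT d60.
exists (Num.min (Num.min (Num.min d1 d2) (Num.min d3 d4)) (Num.min d5 d7)).
  by rewrite !lt_min d10 d20 d30 d40 d50.
move=> u v u0 uc cv vt; rewrite !lt_min -!andbA.
move=> /and5P[vu1 vu2 vu3 vu4 /andP[vu5 vu7]].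
have uv := le_trans uc cv; have vT := le_trans vt t_le.
have uT := le_trans uv vT; have v0 := le_trans u0 uv.
have near r d : u <= r -> r <= v -> v - u < d -> `|r - c| < d.
  by move=> ur rv; apply: le_lt_trans; exact: tag_dist.
have Yu : `|Y u - Y c| < d6 by apply: H7 => //; exact: near.
have Yv : `|Y v - Y c| < d6 by apply: H7 => //; exact: near.
move: Yu Yv; rewrite !lt_min => /and3P[Yu1 Yu2 Yu3] /and3P[Yv1 Yv2 Yv3].
set a := Y v; set b := X u v (Y u).
have phi : X v t a - X u t (Y u) = X v t a - X v t b.
  by rewrite /b (flow_property f_diff df_cont X_deriv X_start).
have bd2 : `|b - Y c| < d2 by apply: H3 => //; exact: near.
have h2 := H2 v a b v0 vt (near _ _ uv (lexx v) vu2) Yv2 bd2.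
have iE := integrable_on_subset u0 vT E_int.
have ig := integrable_on_subset u0 vT rhs_integrable.
have if' := integrable_on_subset u0 vT field_integrable.
set J := integral_on u v E; set n := norm_integral u v E.
have n0 : 0 <= n by exact: norm_integral_ge0.
have Jn : `|J| <= n by exact: integral_on_norm.
have vu0 : 0 <= v - u by rewrite subr_ge0.
have aY : a - Y u - J = integral_on u v (fun r => f r (Y r)).
  rewrite /a Y_increment//.
  have [_ <-] := integrable_onB ig iE; congr (integral_on u v _).
  by apply/funext => r; rewrite /g addrK.
have q1 : `|a - Y u - J - (v - u) *: f c (Y c)| <= eps * (v - u).
  rewrite aY; apply: integral_on_near_cst => //; first exact: ltW.
  move=> r ur rv; apply: ltW; apply: H5; [exact: le_trans ur|exact: le_trans vT|].
  exact: near.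
have q2 : `|b - Y u - (v - u) *: f c (Y c)| <= eps * (v - u).
  by apply: H1 => //; exact: near.
(* Both the E-free part of the increment of Y and the increment of the flow are (v - u) f c (Y c) up
   to eps (v - u), so this common speed cancels. *)
have q : `|a - b - J| <= 2 * eps * (v - u).
  have -> : a - b - J = (a - Y u - J - (v - u) *: f c (Y c)) -
    (b - Y u - (v - u) *: f c (Y c)) by lmod R.
  apply: le_trans (ler_normB _ _) _; rewrite -mulrA mulr_natl mulr2n.
  exact: lerD.
have ab : `|a - b| <= `|a - b - J| + n.
  rewrite -{1}[a - b](subrK J); apply: le_trans (ler_normD _ _) _.
  by rewrite lerD2l.
have WJ : `|W u v - G c J| <= eps * n.
  have iG := integrable_on_subset u0 vt GE_integrable.
  have mGc : strongly_measurable (`[u, v]%classic : set (measurableTypeR R))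
      (fun r => G c (E r)).
    by apply: strongly_measurable_linear HK iE.1; exact: mitv.
  have [iGc _] := integrable_on_le mGc iE (ltW K0) (fun r _ _ => HK (E r)).
  rewrite /J -(integral_on_linear HK iE).
  have [iD <-] := integrable_onB iG iGc.
  apply: le_trans (integral_on_norm iD) _.
  have [] // := integrable_on_le iD.1 iE (ltW eps0).
  move=> r ur rv; apply: H4; [exact: le_trans ur|exact: le_trans vt|exact: near].
have -> : X v t (Y v) - X u t (Y u) - W u v =
    (X v t a - X v t b - G c (a - b)) + G c (a - b - J) - (W u v - G c J).
  have -> : G c (a - b - J) = G c (a - b) - G c J by rewrite linearB.
  by rewrite phi; lmod R.
apply: le_trans (ler_normB _ _) _.
apply: le_trans (lerD (le_trans (ler_normD _ _) (lerD h2 (HK _))) WJ) _.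
exact: (increment_budget vu0 n0 (ltW K0) eps0 eps1 epsK q ab).
Qed.

Lemma variation_formula s : 0 <= s -> s <= t ->
  Y t = X s t (Y s) + W s t.
Proof.
move=> s0 st.
apply/eqP; rewrite -subr_eq0; apply/eqP.
apply: (@norm_le_eps_eq0 _ _ _ (t - s + norm_integral s t E)) => eta eta0.
(* X t t is the identity, so the defect is the left side of the tagged estimate on [s, t], to be
   bounded for every eta. *)
have -> : Y t - (X s t (Y s) + W s t) = X t t (Y t) - X s t (Y s) - W s t.
  by rewrite X_start//; lmod R.
pose P u v := `|X v t (Y v) - X u t (Y u) - W u v| <=
  eta * (v - u + norm_integral u v E).
apply: (@cousin R P s t) => // [u v w su uv vw wt|c sc ct].
  rewrite /P => Puv Pvw; have u0 := le_trans s0 su.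
  have uw := le_trans uv vw.
  have iG := integrable_on_subset u0 wt GE_integrable.
  have iE := integrable_on_subset u0 (le_trans wt t_le) E_int.
  rewrite /W (integral_on_cat uv vw iG) (norm_integral_cat uv vw iE) -/(W u v) -/(W v w).
  have -> : X w t (Y w) - X u t (Y u) - (W u v + W v w) =
    (X v t (Y v) - X u t (Y u) - W u v) + (X w t (Y w) - X v t (Y v) - W v w).
    by lmod R.
  apply: le_trans (ler_normD _ _) _; apply: le_trans (lerD Puv Pvw) _.
  by rewrite -mulrDr ler_wpM2l ?(ltW eta0)// le_eqVlt; apply/orP; left; apply/eqP; ring.
have [d d0 Hd] := local_increment (le_trans s0 sc) ct eta0.
exists d => // u v su uc cv vt vud; apply: Hd => //.
exact: le_trans su.
Qed.

End fixed_end.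
End alekseev_groebner.

(** * From topological hypotheses to epsilon-delta form, and the theorem *)

Lemma continuous_within_eps (R : realType) (V W : normedModType R) (A : set V)
    (g : V -> W) (c : V) : g @ within A (nbhs c) --> g c ->
  forall e : R, 0 < e -> exists2 d : R, 0 < d & forall x, A x -> `|x - c| < d ->
    `|g x - g c| < e.
Proof.
move=> /cvgrPdist_lt H e e0; have /nbhs_normP[d /= d0 Hd] := H e e0.
exists d => // x Ax xc; rewrite distrC; apply: Hd => //=.
by rewrite distrC.
Qed.

Lemma near_within_pair (R : realType) (V : normedModType R) (A : set (R * V))
    (c : R) (y : V) (P : R * V -> Prop) :
  (\forall q \near within A (nbhs (c, y)), P q) ->
  exists2 d : R, 0 < d & forall r x, A (r, x) -> `|r - c| < d -> `|x - y| < d ->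
    P (r, x).
Proof.
move=> /nbhs_ballP[d /= d0 Hd]; exists d => // r x Arx rc xy.
apply: Hd => //; split; rewrite -ball_normE /=; by rewrite distrC.
Qed.

Theorem theorem1p1 (R : realType) (V : completeNormedModType R)
  (V_nontrivial : exists v : V, v != 0)
  (T : R) (T_gt0 : 0 < T)
  (f : R -> V -> V)
  (f_continuous :
    {within `[0, T] `*` [set: V], continuous (fun p : R * V => f p.1 p.2)})
  (f_differentiable : forall t : R, t \in `[0, T] ->
    forall x : V, differentiable (f t) x)
  (df_continuous : forall p : R * V, (`[0, T] `*` [set: V]) p ->
    (fun q : R * V =>
        opnorm (fun v : V => 'd (f q.1) (q.2) v - 'd (f p.1) (p.2) v))
      @ within (`[0, T] `*` [set: V]) (nbhs p) --> (0 : R))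
  (* X s t x is the value at time t of the solution started from x at time s *)
  (X : R -> R -> V -> V)
  (X_continuous : forall (x : V) (s : R), s \in `[0, T] ->
    {within `[s, T], continuous (fun t => X s t x)})
  (X_solution : forall (x : V) (s : R), s \in `[0, T] ->
    forall t : R, t \in `[s, T] ->
    X s t x =
      x + bochner_integral lebesgue_measure `[s, t] (fun r : R => f r (X s r x)))
  (Y E : R -> V)
  (Y_measurable : strongly_measurable (`[0, T] : set R) Y)
  (E_measurable : strongly_measurable (`[0, T] : set R) E)
  (fYE_integrable : (\int[@lebesgue_measure R]_(r in `[0%R, T])
    (`|f r (Y r)| + `|E r|)%R%:E < +oo)%E)
  (Y_eq : forall t : R, t \in `[0, T] ->
    Y t =
      Y 0 + bochner_integral lebesgue_measure `[0, t]
              (fun r : R => f r (Y r) + E r)) :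
  [/\ (forall s t : R, s \in `[0, T] -> t \in `[s, T] ->
        forall x : V, differentiable (X s t) x),
      (forall t : R, t \in `[0, T] ->
        strongly_measurable (`[0, t] : set R)
          (fun r : R => 'd (X r t) (Y r) (E r))),
      (forall t : R, t \in `[0, T] ->
        (\int[@lebesgue_measure R]_(r in `[0%R, t])
          `|'d (X r t) (Y r) (E r)|%:E < +oo)%E) &
      (forall s t : R, s \in `[0, T] -> t \in `[s, T] ->
        Y t = X s t (Y s) +
          bochner_integral lebesgue_measure `[s, t]
            (fun r : R => 'd (X r t) (Y r) (E r)))].
Proof.
have T0 : 0 <= T by exact: ltW.
have itvP (a b r : R) : (r \in `[a, b]) = (a <= r) && (r <= b) by rewrite in_itv.
have memA (r : R) (x : V) : 0 <= r -> r <= T -> (`[0, T] `*` [set: V]) (r, x).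
  by move=> r0 rT; split => //=; rewrite itvP r0 rT.
have fd (t : R) : 0 <= t -> t <= T -> forall x, differentiable (f t) x.
  by move=> t0 tT; apply: f_differentiable; rewrite itvP t0 tT.
have fc (c : R) (y : V) : 0 <= c -> c <= T -> forall e : R, 0 < e ->
    exists2 d : R, 0 < d & forall (r : R) (x : V), 0 <= r -> r <= T -> `|r - c| < d ->
      `|x - y| < d -> `|f r x - f c y| <= e.
  move=> c0 cT e e0.
  have /cvgrPdist_le/(_ e e0)/near_within_pair[d d0 Hd] :=
    (subspace_continuousP _ _).1 f_continuous (c, y) (memA c y c0 cT).
  exists d => // r x r0 rT rc xy; rewrite distrC.
  exact: (Hd r x (memA r x r0 rT) rc xy).
have dfc (c : R) (y : V) : 0 <= c -> c <= T -> forall e : R, 0 < e ->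
    exists2 d : R, 0 < d & forall (r : R) (x : V), 0 <= r -> r <= T -> `|r - c| < d ->
      `|x - y| < d -> forall h, `|'d (f r) x h - 'd (f c) y h| <= e * `|h|.
  move=> c0 cT e e0.
  have /cvgrPdist_le/(_ e e0)/near_within_pair[d d0 Hd] :=
    df_continuous (c, y) (memA c y c0 cT).
  exists d => // r x r0 rT rc xy h.
  (* Bounds on both derivatives make [opnorm] of their difference a true supremum. *)
  have [K _ HK] := differentiable_bound (fd r r0 rT x).
  have [L _ HL] := differentiable_bound (fd c c0 cT y).
  have := Hd r x (memA r x r0 rT) rc xy; rewrite sub0r normrN /= => Hop.
  apply: le_trans (opnorm_bound (K := K + L)
    (A := fun v => 'd (f r) x v - 'd (f c) y v) _ _ h) _.
  - by move=> v; rewrite mulrDl; apply: le_trans (ler_normB _ _) (lerD _ _).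
  - move=> k v; rewrite scalerBr.
    by congr (_ - _); rewrite linearZ.
  - by rewrite ler_wpM2r//; apply: le_trans (ler_norm _) Hop.
have Xc (s : R) (x : V) : 0 <= s -> s <= T -> continuous_on s T (fun t => X s t x).
  move=> s0 sT c sc cT e e0.
  have cS : (`[s, T]%classic : set R) c by rewrite /= itvP sc cT.
  have sI : s \in `[0, T] by rewrite itvP s0 sT.
  have [d d0 Hd] := continuous_within_eps
    ((subspace_continuousP _ _).1 (X_continuous x s sI) c cS) e0.
  exists d => // r sr rT rc; apply: Hd => //.
  by rewrite /= itvP sr rT.
have Xs (s t : R) (x : V) : 0 <= s -> s <= t -> t <= T ->
    X s t x = x + integral_on s t (fun r => f r (X s r x)).
  move=> s0 st tT; apply: X_solution; rewrite itvP ?s0 ?st ?tT//.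
  exact: le_trans tT.
have fYm := field_measurable T0 fc Y_measurable.
(* Prepares the comparison that splits the single integrability assumption into one for f (r, Y r)
   and one for E. *)
have fYE_meas : measurable_fun (`[0, T]%classic : set (measurableTypeR R))
    (fun r => (`|f r (Y r)| + `|E r|)%:E).
  apply/measurable_EFinP; apply: measurable_funD.
    exact: (strongly_measurable_norm (mitv 0 T) fYm).
  exact: (strongly_measurable_norm (mitv 0 T) E_measurable).
have fY_int : (\int[@lebesgue_measure R]_(r in `[0%R, T])
    (`|f r (Y r)|)%:E < +oo)%E.
  apply: le_lt_trans fYE_integrable; apply: ge0_le_integral => //.
  - exact: (norm_measurable fYm).
  - by move=> r _; rewrite lee_fin lerDl.
have E_int : integrable_on 0 T E.
  split; first exact: E_measurable.
  apply: le_lt_trans fYE_integrable; apply: ge0_le_integral => //.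
  - exact: (norm_measurable E_measurable).
  - by move=> r _; rewrite lee_fin lerDr.
have Ye (t : R) : 0 <= t -> t <= T ->
    Y t = Y 0 + integral_on 0 t (fun r => f r (Y r) + E r).
  by move=> t0 tT; apply: Y_eq; rewrite itvP t0 tT.
split.
- move=> s t; rewrite !itvP => /andP[s0 sT] /andP[st tT] x.
  exact: (X_differentiable fd fc dfc Xc Xs tT x s0 st).
- move=> t; rewrite itvP => /andP[t0 tT].
  exact: (GE_measurable T0 fd fc dfc Xc Xs Y_measurable E_int fY_int Ye t0 tT).
- move=> t; rewrite itvP => /andP[t0 tT].
  by have [_] :=
    GE_integrable T0 fd fc dfc Xc Xs Y_measurable E_int fY_int Ye t0 tT.
- move=> s t; rewrite !itvP => /andP[s0 sT] /andP[st tT].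
  exact: (variation_formula T0 fd fc dfc Xc Xs Y_measurable E_int fY_int Ye
    (le_trans s0 st) tT s0 st).
Qed.
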